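(* Let $K$ be a field of characteristic $0$ and let $f_0,f_1,f_2,\ldots\in K$. For $i\ge1$ let $$g_i=g_i(x)=\sum_{\substack{C\in\mathcal{RCCD}\\ b(C)\ge i}}x^{|C|}f_C\,f_{b(C)-i}\in K[[x]].$$ Then $$g_k=g_1\left(2x\frac{d}{dx}-1\right)g_{k-1}\qquad\text{for all }k\ge2,$$ where the right-hand side is the product of $g_1$ with $2x\,g_{k-1}'(x)-g_{k-1}(x)$.
   Context: A rooted chord diagram of degree (size) $n\ge1$ consists of $2n$ points $p_1,\dots,p_{2n}$ numbered counterclockwise on a circle, with $p_1$ the root, together with a partition of these points into $n$ pairs called chords; equivalently it is a perfect matching of $\{1,\dots,2n\}$. Two chords $\{p_a,p_c\}$ and $\{p_{a'},p_{c'}\}$ with $a<c$, $a'<c'$, $a<a'$ cross if $a<a'<c<c'$. The diagram is connected if the graph whose vertices are the chords and whose edges are the crossing pairs is connected. $\mathcal{RCCD}$ is the set of rooted connected chord diagrams, and $|C|$ is the number of chords of $C$. The counterclockwise order on chords is the order by smaller endpoint index. A chord is terminal if it crosses no chord that is larger in the counterclockwise order. The intersection order on the chords of a connected diagram is defined recursively: the counterclockwise-smallest chord comes first; after deleting it, the remaining chords split into connected components (of the crossing graph), which are listed by increasing counterclockwise-smallest chord; then come the chords of the first component in the intersection order of that component, then those of the second component, and so on. Label the chords $1,\dots,n$ in the intersection order. Let $t_1<t_2<\dots<t_{k+1}$ be the labels of the terminal chords. Then $b(C)=t_1$, and with the gaps $\delta_i=t_{i+1}-t_i$ ($1\le i\le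 k$), $$f_C=f_0^{\,n-k-1}f_{\delta_1}f_{\delta_2}\cdots f_{\delta_k}.$$ *)

(* Defs.v *)
From mathcomp Require Import all_boot all_order all_algebra.

Set Implicit Arguments.
Unset Strict Implicit.
Unset Printing Implicit Defensive.

Import GRing.Theory.

(* A chord joining the points a < c is encoded as the ordered pair (a, c).    *)
(* Points are numbered from 0, so the root point is 0.                        *)
Definition chord (m : nat) : finType := ('I_m * 'I_m)%type.

Section ChordSets.

Variable m : nat.
Implicit Types (A B : chord m) (S : {set chord m}).

Definition is_endpoint (p : 'I_m) A : bool := (p == A.1) || (p == A.2).

Definition perfect_matching S : bool :=
  [forall A in S, A.1 < A.2]
  && [forall p : 'I_m, #|[set A in S | is_endpoint p A]| == 1].

Definition ccw_lt A B : bool := A.1 < B.1.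

Definition ccw_le A B : bool := A.1 <= B.1.

Definition crosses A B : bool :=
  [&& A.1 < B.1, B.1 < A.2 & A.2 < B.2]
  || [&& B.1 < A.1, A.1 < B.2 & B.2 < A.2].

Definition crossing_graph S : rel (chord m) :=
  [rel A B | [&& A \in S, B \in S & crosses A B]].

Definition connected_diagram S : bool :=
  [forall A in S, forall B in S, connect (crossing_graph S) A B].

Definition component S A : {set chord m} :=
  [set B in S | connect (crossing_graph S) A B].

Definition ccw_enum S : seq (chord m) := sort ccw_le (enum S).

(* Each component is listed once, through its counterclockwise-smallest       *)
(* chord.                                                                     *)
Definition components S : seq {set chord m} :=
  [seq component S A | A <- ccw_enum S
                     & [forall B in component S A, ccw_le A B]].

(* The first argument bounds the depth of the recursion; #|S| is always       *)
(* enough, since each call deletes a chord.                                   *)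
Fixpoint intersection_order_rec (d : nat) S : seq (chord m) :=
  if d is d'.+1 then
    if ccw_enum S is r :: _ then
      r :: flatten [seq intersection_order_rec d' D | D <- components (S :\ r)]
    else [::]
  else [::].

Definition intersection_order S : seq (chord m) :=
  intersection_order_rec #|S| S.

Definition label S A : nat := (index A (intersection_order S)).+1.

Definition terminal S A : bool :=
  [forall B in S, ccw_lt A B ==> ~~ crosses A B].

(* Increasing, because the chords are read in the intersection order.         *)
Definition terminal_labels S : seq nat :=
  [seq label S A | A <- intersection_order S & terminal S A].

Definition b S : nat := head 0 (terminal_labels S).

Definition gaps S : seq nat :=
  if terminal_labels S is t1 :: t then pairmap (fun u v => v - u) t1 t
  else [::].

End ChordSets.

Definition RCCD (n : nat) : {set {set chord n.*2}} :=
  [set C | [&& 0 < n, perfect_matching C & connected_diagram C]].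

Local Open Scope ring_scope.

Definition f_of (K : fieldType) (f : nat -> K) (m : nat) (C : {set chord m}) :
    K :=
  f 0%N ^+ (#|C| - size (gaps C) - 1)%N * \prod_(d <- gaps C) f d.

(* A formal power series is represented by its sequence of coefficients.      *)
Section PowerSeries.

Variable K : fieldType.

Definition fps : Type := nat -> K.

Implicit Types u v : fps.

Definition fpsX : fps := fun n => (n == 1%N)%:R.

Definition fps_sub u v : fps := fun n => u n - v n.

Definition fps_scale (a : K) u : fps := fun n => a * u n.

Definition fps_mul u v : fps := fun n => \sum_(i < n.+1) u i * v (n - i)%N.

Definition fps_deriv u : fps := fun n => u n.+1 *+ n.+1.

End PowerSeries.

(* The chord diagrams C with |C| = n contribute to the coefficient of x ^ n.  *)
Definition g (K : fieldType) (f : nat -> K) (i : nat) : fps K :=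
  fun n => \sum_(C in RCCD n | (i <= b C)%N) f_of f C * f (b C - i)%N.

(* Main.v *)
(* Root-share decomposition. In a connected diagram C with root chord r and   *)
(* |C| >= 2, let D be the first component of C :\ r. Every component of       *)
(* C :\ r crosses r, so the components are nested and C :\: D sits, apart     *)
(* from the root point, in a single one of the 2 |D| - 1 inner gaps of D.     *)
(* Thus C corresponds to a pair of connected diagrams (C' = C :\: D, D) and a *)
(* gap. The intersection order of C is r, then the order of D, then that of   *)
(* C' without r, whence b C = b D + 1 and f_C = f_C' f_(b C' - 1) f_D; the    *)
(* factor 2 |D| - 1 is the operator 2 x d/dx - 1.                             *)
Require Import Defs.
From mathcomp Require Import all_boot all_order all_algebra.
From mathcomp Require Import zify ring.

Set Implicit Arguments.
Unset Strict Implicit.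
Unset Printing Implicit Defensive.

Import GRing.Theory.

(** The identity is checked coefficient by coefficient. For k at least 2, a diagram C with b C at
    least k has two or more chords, hence a root chord r and a root share D, the first component
    left when r is deleted; put C' = C :\: D. Both C' and D are connected, and C is recovered from
    C', D and the gap of D that holds the points of C' other than the root point.

    The labels follow the decomposition. The root is not terminal in C, nor in C' unless C' is a
    single chord. So the terminal labels of C are those of D shifted by 1, followed (when C' has
    several chords) by those of C' shifted by |D| ([terminal_labels_share]). The last chord of D is
    terminal, so the gap created at the junction is b C' - 1; if C' is a single chord this number is
    0, and the matching f_0 comes from the power of f_0. Hence b C = b D + 1 ([b_share]) and f_C =
    f_C' f_(b C' - 1) f_D ([f_of_share]): the weight f_C f_(b C - k) is the weight of C' in g_1
    times the weight of D in g_(k-1).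

    For each fixed gap, [glue] and [unglue] form a bijection ([glue_RCCD], [unglueP]), which gives
    [sum_in_position]. That all of C' falls into one gap is the geometric part, [share_same_gap] and
    [share_position]. The 2|D| - 1 gaps give the factor in [sum_share], and summing over |D| gives
    the product of series. *)

Section Components.

(** * Components of the crossing graph and the counterclockwise order *)

Variable m : nat.
Implicit Types (A B X Y : chord m) (S T D : {set chord m}).

Lemma crossesC A B : crosses A B = crosses B A.
Proof. by rewrite /crosses orbC. Qed.

Lemma connect_crossing_sym S : connect_sym (crossing_graph S).
Proof.
by apply: sym_connect_sym => A B; rewrite /crossing_graph /= crossesC andbCA.
Qed.

(** Connectivity is handled through sets closed under crossing rather than through paths: a
    component is the least closed set around a chord ([component_min]), and a connected diagram lies
    in every closed set that it meets ([connected_sub], with converse [connected_intro]). *)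
Definition crossing_closed S T :=
  forall A B, A \in T -> B \in S -> crosses A B -> B \in T.

Lemma component_self S A : A \in S -> A \in component S A.
Proof. by move=> AS; rewrite inE AS connect0. Qed.

Lemma component_sub S A : component S A \subset S.
Proof. by apply/subsetP => B; rewrite inE => /andP[]. Qed.

Lemma component_closed S A : crossing_closed S (component S A).
Proof.
move=> X Y; rewrite !inE => /andP[XS cAX] YS XY; rewrite YS /=.
by apply: connect_trans cAX (connect1 _); apply/and3P.
Qed.

Lemma component_min S T A :
  A \in T -> crossing_closed S T -> component S A \subset T.
Proof.
move=> AT clT; apply/subsetP => B; rewrite inE => /andP[_ cAB].
suff clo : closed (crossing_graph S) T by rewrite -(closed_connect clo cAB).
apply: intro_closed; first exact: connect_crossing_sym.
by move=> X Y /and3P[_ YS XY] XT; apply: clT XT YS XY.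
Qed.

Lemma component_eq S A X : X \in component S A -> component S X = component S A.
Proof.
rewrite inE => /andP[_ cAX]; apply/setP => B; rewrite !inE.
by rewrite (same_connect (connect_crossing_sym S) cAX).
Qed.

Lemma connected_sub S T A : connected_diagram S -> A \in S -> A \in T ->
  crossing_closed S T -> S \subset T.
Proof.
move=> conS AS AT clT; apply: subset_trans (component_min AT clT).
apply/subsetP => B BS; rewrite inE BS /=.
by move/forall_inP: conS => /(_ A AS) /forall_inP; apply.
Qed.

Lemma connected_intro S :
  (forall A T, A \in S -> A \in T -> T \subset S -> crossing_closed S T ->
     S \subset T) ->
  connected_diagram S.
Proof.
move=> cutS; apply/forall_inP => A AS; apply/forall_inP => B BS.
have /subsetP/(_ B BS) : S \subset component S A.
  by apply: (cutS A) => //; [exact: component_self | exact: component_sub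
                            | exact: component_closed].
by rewrite inE => /andP[].
Qed.

Lemma component_connected S A : connected_diagram (component S A).
Proof.
apply: connected_intro => X T XD XT sTD clT; rewrite -(component_eq XD).
apply: component_min => // Y Z YT ZS YZ; apply: (clT Y) => //.
exact: component_closed (subsetP sTD _ YT) ZS YZ.
Qed.

(** No chord outside a component crosses it, so removing the component cuts no path of another
    one. *)
Lemma component_setD T A X : X \in T :\: component T A ->
  component (T :\: component T A) X = component T X.
Proof.
set D := component T A => XTD; have XT : X \in T by case/setDP: XTD.
have clTD Y Z : Y \in T :\: D -> Z \in T -> crosses Y Z -> Z \in T :\: D.
  move=> /setDP[YT YD] ZT YZ; rewrite inE ZT andbT; apply: contra YD => ZD.
  by apply: component_closed ZD YT _; rewrite crossesC.
apply/eqP; rewrite eqEsubset; apply/andP; split; apply: component_min.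
- exact: component_self.
- by move=> Y Z YD /setDP[ZT _]; apply: component_closed.
- exact: component_self.
- move=> Y Z YD ZT YZ; apply: (component_closed YD) => //.
  by apply: clTD YZ => //; apply: (subsetP (component_sub _ _) _ YD).
Qed.

(** This makes the counterclockwise order strict, so that [ccw_enum] does not depend on how ties are
    broken. It holds in every matching and passes to subsets. *)
Definition starts_inj S := {in S &, injective (fun A => A.1)}.

Lemma starts_injS S T : T \subset S -> starts_inj S -> starts_inj T.
Proof. by move=> /subsetP sTS injS A B /sTS AS /sTS BS; apply: injS. Qed.

Lemma ccw_lt_trans : transitive (@ccw_lt m).
Proof. by move=> Y X Z; apply: ltn_trans. Qed.

Lemma ccw_lt_irr : irreflexive (@ccw_lt m).
Proof. by move=> X; apply: ltnn. Qed.

Lemma mem_ccw_enum S : ccw_enum S =i S.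
Proof. by move=> A; rewrite mem_sort mem_enum. Qed.

Lemma ccw_enum_sorted S : starts_inj S -> sorted (@ccw_lt m) (ccw_enum S).
Proof.
move=> injS; 
rewrite -[sorted _ _](@sorted_map _ _ (fun A => val A.1) ltn).
rewrite ltn_sorted_uniq_leq; apply/andP; split.
  rewrite map_inj_in_uniq ?sort_uniq ?enum_uniq // => A B.
  by rewrite !mem_ccw_enum => AS BS /val_inj; apply: injS.
by rewrite (@sorted_map _ _ (fun A => val A.1)); apply: sort_sorted => A B;
  apply: leq_total.
Qed.

Definition first_chord S A := A \in S /\ {in S, forall B, ccw_le A B}.

Lemma first_chordP S : S != set0 -> exists A, first_chord S A.
Proof.
case/set0Pn => A0 A0S.
case: (@arg_minnP _ A0 (mem S) (fun A => val A.1) A0S) => A AS minA.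
by exists A.
Qed.

Lemma first_chord_lt S A B : starts_inj S -> first_chord S A -> B \in S ->
  B != A -> ccw_lt A B.
Proof.
move=> injS [AS minA] BS neBA.
have := minA B BS; rewrite /ccw_lt /ccw_le ltn_neqAle => ->; rewrite andbT.
by apply: contra neBA => /eqP/val_inj/(injS A B AS BS) ->.
Qed.

Lemma ccw_enum_first S A : starts_inj S -> first_chord S A ->
  ccw_enum S = A :: ccw_enum (S :\ A).
Proof.
move=> injS firstA; have [AS _] := firstA.
have injSA : starts_inj (S :\ A) by apply: starts_injS injS; apply: subsetDl.
apply: (irr_sorted_eq ccw_lt_trans ccw_lt_irr); first exact: ccw_enum_sorted.
  rewrite /= path_min_sorted ?ccw_enum_sorted //.
  apply/allP => B; rewrite mem_ccw_enum => /setD1P[neBA BS].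
  exact: first_chord_lt firstA BS neBA.
move=> B; rewrite in_cons !mem_ccw_enum in_setD1.
by case: eqP => // ->.
Qed.

Definition leads_component S A := [forall B in component S A, ccw_le A B].

Lemma componentsE S :
  components S = [seq component S A | A <- ccw_enum S & leads_component S A].
Proof. by []. Qed.

Lemma components_sub S D : D \in components S -> D \subset S.
Proof. by case/mapP => A _ ->; apply: component_sub. Qed.

Lemma components0 : components (set0 : {set chord m}) = [::].
Proof.
rewrite componentsE; suff -> : ccw_enum (set0 : {set chord m}) = [::] by [].
by apply/size0nil; rewrite size_sort -cardE cards0.
Qed.

(** Among the chords of its component only the smallest chord [A] is a leader; the remaining leaders
    are those of the diagram without that component, where by [component_setD] they have the same
    components. *)
Lemma components_first T A : starts_inj T -> first_chord T A ->
  components T = component T A :: components (T :\: component T A).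
Proof.
move=> injT firstA; have [AT minA] := firstA.
rewrite 2!componentsE (ccw_enum_first injT firstA) /=.
have -> : leads_component T A.
  by apply/forall_inP => B /(subsetP (component_sub _ _)); apply: minA.
rewrite /=; congr cons; set D := component T A.
have sTDT : T :\: D \subset T by apply: subsetDl.
have -> : [seq X <- ccw_enum (T :\ A) | leads_component T X]
        = [seq X <- ccw_enum (T :\: D) | leads_component (T :\: D) X].
  apply: (irr_sorted_eq ccw_lt_trans ccw_lt_irr).
  - apply: sorted_filter; first exact: ccw_lt_trans.
    by apply/ccw_enum_sorted/(starts_injS _ injT)/subsetDl.
  - apply: sorted_filter; first exact: ccw_lt_trans.
    by apply/ccw_enum_sorted/(starts_injS _ injT).
  move=> X; rewrite !mem_filter !mem_ccw_enum.
  apply/andP/andP => -[leadX XT].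
    have [neXA XT'] := setD1P XT.
    suff XTD : X \in T :\: D.
      by split=> //; rewrite /leads_component component_setD.
    rewrite inE XT' andbT; apply/negP => XD.
    have AX : A \in component T X by rewrite (component_eq XD) component_self.
    have := first_chord_lt injT firstA XT' neXA.
    move/forall_inP: leadX => /(_ A AX).
    by rewrite /ccw_le /ccw_lt leqNgt => /negP.
  have /setDP[XT' XD] := XT; split.
    by rewrite /leads_component -(component_setD XT).
  rewrite in_setD1 XT' andbT; apply: contra XD => /eqP ->.
  exact: component_self.
apply/eq_in_map => X; rewrite mem_filter mem_ccw_enum => /andP[_ XTD].
by rewrite component_setD.
Qed.

End Components.

(** * Intersection order and the root share *)

Section IntersectionOrder.

Variable m : nat.
Implicit Types (A B X Y r : chord m) (S T D : {set chord m}).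

Lemma ccw_enum_mem_head S r s : ccw_enum S = r :: s -> r \in S.
Proof. by move=> e; rewrite -mem_ccw_enum e mem_head. Qed.

(** A recursive call inherits its depth bound from the whole diagram, not from the component; this
    lets the call be replaced by [intersection_order] of the component. *)
Lemma intersection_order_rec_depth d1 d2 S : #|S| <= d1 -> #|S| <= d2 ->
  intersection_order_rec d1 S = intersection_order_rec d2 S.
Proof.
elim: d1 d2 S => [|d1 IH] [|d2] S //=.
- rewrite leqn0 cards_eq0 => /eqP-> _.
  by case e: ccw_enum => [//|r s]; move/ccw_enum_mem_head: e; rewrite inE.
- move=> _; rewrite leqn0 cards_eq0 => /eqP->.
  by case e: ccw_enum => [//|r s]; move/ccw_enum_mem_head: e; rewrite inE.
case e: ccw_enum => [//|r s]; rewrite (cardsD1 r S) (ccw_enum_mem_head e) !ltnS.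
move=> le1 le2; congr (_ :: flatten _); apply/eq_in_map => D /components_sub.
by move=> /subset_leq_card leD; apply: IH; apply: leq_trans leD _.
Qed.

Lemma intersection_order0 : intersection_order (set0 : {set chord m}) = [::].
Proof. by rewrite /intersection_order cards0. Qed.

Lemma intersection_order_first S r : starts_inj S -> first_chord S r ->
  intersection_order S
    = r :: flatten [seq intersection_order D | D <- components (S :\ r)].
Proof.
move=> injS firstr; have [rS _] := firstr.
rewrite /intersection_order (cardsD1 r S) rS /= (ccw_enum_first injS firstr).
congr (_ :: flatten _); apply/eq_in_map => D /components_sub sD.
by apply: intersection_order_rec_depth; rewrite ?subset_leq_card.
Qed.

(** The root share: [r] is the root chord and [D] is the first component after its deletion, found
    through its smallest chord [A]. *)
Definition share_of S r D := exists A,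
  [/\ first_chord S r, first_chord (S :\ r) A & D = component (S :\ r) A].

Lemma share_of_sub S r D : share_of S r D -> D \subset S :\ r.
Proof. by case=> A [_ _ ->]; apply: component_sub. Qed.

Lemma share_of_first S r D : share_of S r D -> first_chord (S :\: D) r.
Proof.
move=> shS; have [A [[rS minr] _ _]] := shS.
split; last by move=> B /setDP[BS _]; apply: minr.
rewrite inE rS andbT; apply/negP => /(subsetP (share_of_sub shS)).
by rewrite in_setD1 eqxx.
Qed.

(** [S :\: D] has the same root [r], and its components beyond [r] are those of [S :\ r] after the
    first; [behead] removes the second copy of [r]. *)
Lemma intersection_order_share S r D : starts_inj S -> share_of S r D ->
  intersection_order S
    = r :: intersection_order D ++ behead (intersection_order (S :\: D)).
Proof.
move=> injS shS; have firstr' := share_of_first shS.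
have [A [firstr firstA eD]] := shS.
have injSr : starts_inj (S :\ r) by apply: starts_injS injS; apply: subsetDl.
rewrite (intersection_order_first injS firstr).
rewrite (components_first injSr firstA) -eD /=; congr (_ :: _ ++ _).
rewrite (@intersection_order_first (S :\: D) r) //=; last first.
  by apply: starts_injS injS; apply: subsetDl.
by rewrite !setDDl setUC.
Qed.

(** Strong induction on the number of chords: with two or more chords, both the share and its
    complement are proper subsets, as the share is nonempty and misses the root. *)
Lemma share_ind (P : {set chord m} -> Prop) :
  P set0 -> (forall r, P [set r]) ->
  (forall S r D, starts_inj S -> share_of S r D -> P D -> P (S :\: D) -> P S) ->
  forall S, starts_inj S -> P S.
Proof.
move=> P0 P1 Psh S; have [n] := ubnP #|S|; elim: n S => // n IH S leSn injS.
have [-> // | S0] := eqVneq S set0.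
have [r firstr] := first_chordP S0; have [rS _] := firstr.
have [e | Sr0] := eqVneq (S :\ r) set0.
  by rewrite -(setD1K rS) e setU0.
have [A firstA] := first_chordP Sr0.
have shS : share_of S r (component (S :\ r) A) by exists A.
have /subset_leq_card leD := share_of_sub shS.
have cS : #|S| = #|S :\ r|.+1 by rewrite (cardsD1 r) rS.
apply: (Psh _ _ _ injS shS); apply: IH.
- by move: leSn; rewrite cS !ltnS; apply: leq_ltn_trans.
- apply: starts_injS injS; apply: subset_trans (share_of_sub shS) _.
  exact: subsetDl.
- rewrite -ltnS; apply: leq_trans leSn; rewrite ltnS; apply: proper_card.
  rewrite properEneq subsetDl andbT; apply/eqP => /setP/(_ A).
  case: firstA => AT _; rewrite inE component_self //=.
  by move: AT; rewrite in_setD1 => /andP[_ ->].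
- by apply: starts_injS injS; apply: subsetDl.
Qed.

Lemma intersection_order1 r : intersection_order [set r] = [:: r].
Proof.
rewrite (@intersection_order_first _ r); first by rewrite setDv components0.
  by move=> A B /set1P-> /set1P->.
by split=> [|B /set1P->]; [rewrite set11 | rewrite /ccw_le].
Qed.

Lemma intersection_order_perm S : starts_inj S ->
  perm_eq (intersection_order S) (enum S).
Proof.
elim/share_ind => {S} [|r|S r D injS shS pD pSD].
- by rewrite intersection_order0 enum_set0.
- by rewrite intersection_order1 enum_set1.
have injSD : starts_inj (S :\: D) by apply: starts_injS injS; apply: subsetDl.
have sD := share_of_sub shS.
rewrite (intersection_order_share injS shS).
have eSD : intersection_order (S :\: D)
         = r :: behead (intersection_order (S :\: D)).
  rewrite {1}(intersection_order_first injSD (share_of_first shS)).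
  by rewrite (intersection_order_first injSD (share_of_first shS)).
rewrite -cat1s perm_catCA /= -eSD.
apply: (perm_trans (perm_cat pD pSD)).
apply: uniq_perm; rewrite ?enum_uniq //.
  rewrite cat_uniq !enum_uniq andbT /=; apply/hasPn => X.
  by rewrite !mem_enum => /setDP[].
move=> X; rewrite mem_cat !mem_enum inE.
by case XD: (X \in D) => //=; move/subsetP: sD => /(_ X XD) /setD1P[_ ->].
Qed.

Lemma mem_intersection_order S : starts_inj S -> intersection_order S =i S.
Proof.
by move=> injS A; rewrite (perm_mem (intersection_order_perm injS)) mem_enum.
Qed.

Lemma size_intersection_order S : starts_inj S ->
  size (intersection_order S) = #|S|.
Proof.
by move=> injS; rewrite (perm_size (intersection_order_perm injS)) -cardE.
Qed.

Lemma intersection_order_uniq S : starts_inj S -> uniq (intersection_order S).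
Proof.
by move=> injS; rewrite (perm_uniq (intersection_order_perm injS)) enum_uniq.
Qed.

End IntersectionOrder.

(** * Terminal labels, gaps and weights under the decomposition *)

Section TerminalLabels.

Variable m : nat.
Implicit Types (A B X Y r : chord m) (S T D : {set chord m}).

(** A chord crossing [X] lies in [D] or is the root, and the root is smaller than [X], so it never
    affects terminality. *)
Lemma terminal_share S r D X : starts_inj S -> share_of S r D -> X \in D ->
  terminal S X = terminal D X.
Proof.
move=> injS [A [firstr firstA eD]] XD.
have sDS : D \subset S :\ r by rewrite eD component_sub.
have /setD1P[neXr XS] := subsetP sDS X XD.
apply/forall_inP/forall_inP => term B BD.
  by apply: term; apply: (subsetP (subsetDl S [set r])); apply: (subsetP sDS).
apply/implyP => ltXB; apply/negP => XB.
suff BD' : B \in D by have /implyP/(_ ltXB) := term B BD'; rewrite XB.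
rewrite eD; apply: (component_closed _ _ XB); first by rewrite -eD.
rewrite in_setD1 BD andbT; apply/eqP => eBr.
have := first_chord_lt injS firstr XS neXr.
by rewrite -eBr; move: ltXB; rewrite /ccw_lt; lia.
Qed.

(** A chord outside [D] other than the root crosses nothing in [D]. *)
Lemma terminal_share_compl S r D X : starts_inj S -> share_of S r D ->
  X \in S :\: D -> X != r -> terminal S X = terminal (S :\: D) X.
Proof.
move=> injS [A [firstr firstA eD]] XSD neXr; have /setDP[XS XD] := XSD.
have XSr : X \in S :\ r by rewrite in_setD1 neXr.
apply/forall_inP/forall_inP => term B BS.
  by apply: term; apply: (subsetP (subsetDl S D)).
apply/implyP => ltXB; apply/negP => XB.
suff BSD : B \in S :\: D by have /implyP/(_ ltXB) := term B BSD; rewrite XB.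
rewrite inE BS andbT; apply: contra XD => BD; rewrite eD.
apply: (@component_closed _ (S :\ r) A B) => //; first by rewrite -eD.
by rewrite crossesC.
Qed.

(** The terminal labels are the positions, counted from 1, of the true bits. In this form the
    decomposition of a diagram becomes a concatenation. *)
Definition terminal_bits S : bitseq :=
  [seq terminal S A | A <- intersection_order S].

Lemma terminal_labelsE S : starts_inj S ->
  terminal_labels S = mask (terminal_bits S) (iota 1 #|S|).
Proof.
move=> injS; rewrite /terminal_labels /terminal_bits filter_mask map_mask.
congr mask; rewrite -(size_intersection_order injS) /label.
move: (intersection_order S) (intersection_order_uniq injS) => s us.
apply: (@eq_from_nth _ 0); first by rewrite size_map size_iota.
rewrite size_map => j ltj; case: s us ltj => // x0 s us ltj.
by rewrite (nth_map x0) // index_uniq // nth_iota.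
Qed.

Lemma size_terminal_bits S : starts_inj S -> size (terminal_bits S) = #|S|.
Proof. by move=> injS; rewrite size_map size_intersection_order. Qed.

Lemma terminal1 r : terminal [set r] r.
Proof. by apply/forall_inP => B /set1P->; rewrite ccw_lt_irr. Qed.

Lemma terminal_bits_share S r D : starts_inj S -> share_of S r D ->
  terminal_bits S
    = terminal S r :: terminal_bits D ++ behead (terminal_bits (S :\: D)).
Proof.
move=> injS shS; have injSD : starts_inj (S :\: D).
  by apply: starts_injS injS; apply: subsetDl.
have injD : starts_inj D.
  apply: starts_injS injS; apply: subset_trans (share_of_sub shS) _.
  exact: subsetDl.
rewrite /terminal_bits (intersection_order_share injS shS) /= map_cat.
rewrite -behead_map.
congr (_ :: _ ++ _).
  apply/eq_in_map => X; rewrite mem_intersection_order // => XD.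
  exact: terminal_share shS XD.
have := intersection_order_uniq injSD; have := mem_intersection_order injSD.
rewrite (intersection_order_first injSD (share_of_first shS)) /=.
set s := flatten _ => mems /andP[rs _]; apply/eq_in_map => X Xs.
apply: terminal_share_compl shS _ _ => //.
  by rewrite -mems in_cons Xs orbT.
by apply: contraNneq rs => <-.
Qed.

Lemma share_of_neq0 S r D : share_of S r D -> D != set0.
Proof.
by case=> A [_ [AS _] ->]; apply/set0Pn; exists A; apply: component_self.
Qed.

Lemma last_terminal_bits S : starts_inj S -> last true (terminal_bits S).
Proof.
elim/share_ind => {S} [|r|S r D injS shS].
- by rewrite /terminal_bits intersection_order0.
- by rewrite /terminal_bits intersection_order1 /= terminal1.
rewrite (terminal_bits_share injS shS).
have : terminal_bits D != [::].
  rewrite -size_eq0 size_terminal_bits ?cards_eq0 ?(share_of_neq0 shS) //.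
  apply: starts_injS injS; apply: subset_trans (share_of_sub shS) _.
  exact: subsetDl.
(* The last bit comes from [S :\: D], or from [D] when [S :\: D] consists of the root alone and its
   beheaded bits are empty. *)
rewrite /= last_cat; case: (terminal_bits D) => //= x s _ ->.
by case: terminal_bits => //= y [].
Qed.

Lemma last_mask (T : Type) (x : T) (bs : bitseq) (s : seq T) :
  size bs = size s -> last true bs -> last x (mask bs s) = last x s.
Proof.
elim: bs s x => [|c bs IH] [|y s] x //= [sz] lst.
case: bs IH sz lst => [|d bs] IH sz /= lst; first by case: s sz; rewrite // lst.
by case: c lst => lst; rewrite [LHS]IH //; case: s sz {IH}.
Qed.

Lemma terminal_labels_last S : starts_inj S -> S != set0 ->
  last 0 (terminal_labels S) = #|S|.
Proof.
move=> injS S0; rewrite terminal_labelsE // last_mask.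
- rewrite -cards_eq0 in S0; case: #|S| S0 => // n _.
  by rewrite -nth_last size_iota nth_iota.
- by rewrite size_terminal_bits // size_iota.
- exact: last_terminal_bits.
Qed.

Lemma size_terminal_labels S : starts_inj S -> size (terminal_labels S) <= #|S|.
Proof.
move=> injS; rewrite /terminal_labels size_map size_filter.
by rewrite -(size_intersection_order injS) count_size.
Qed.

Lemma b_gt0 S : starts_inj S -> S != set0 -> 0 < b S.
Proof.
move=> injS S0; have := terminal_labels_last injS S0; rewrite /b.
have : all (leq 1) (terminal_labels S) by apply/allP => _ /mapP[A _ ->].
case: (terminal_labels S) => [_ /=|t s /andP[] //].
by move=> /esym/eqP; rewrite cards_eq0 (negPf S0).
Qed.

(** Chords of [D] move one place, past [r]. A chord with label j > 1 in [S :\: D] moves past all of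
    [D], to j + |D|. The root contributes no label, except in [S :\: D] when it is alone there; that
    label 1 disappears in [S]. *)
Lemma terminal_labels_share S r D : starts_inj S -> share_of S r D ->
    ~~ terminal S r -> (S :\: D == [set r]) || ~~ terminal (S :\: D) r ->
  terminal_labels S = [seq 1 + x | x <- terminal_labels D]
    ++ if S :\: D == [set r] then [::]
       else [seq #|D| + x | x <- terminal_labels (S :\: D)].
Proof.
move=> injS shS nterm ntermSD.
have injSD : starts_inj (S :\: D).
  by apply: starts_injS injS; apply: subsetDl.
have sDS : D \subset S.
  by apply: subset_trans (share_of_sub shS) _; apply: subsetDl.
have injD : starts_inj D by apply: starts_injS injS.
have [rSD _] := share_of_first shS.
have cSD : #|S :\: D| = (#|(S :\: D) :\ r|).+1 by rewrite (cardsD1 r) rSD.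
have cS : #|S| = (#|D| + #|(S :\: D) :\ r|).+1.
  by rewrite -addnS -cSD cardsD (setIidPr sDS) subnKC // subset_leq_card.
rewrite !terminal_labelsE // (terminal_bits_share injS shS) cS (negPf nterm) /=.
rewrite iotaD mask_cat ?size_terminal_bits ?size_iota // -[2]/(1 + 1) iotaDl.
rewrite map_mask; congr (_ ++ _); case: eqP ntermSD => [eSD _|_ /= ntermSD].
  by rewrite eSD /terminal_bits intersection_order1.
(* The root bit is false, so putting it back in front adds no label. *)
have -> : terminal_bits (S :\: D) = false :: behead (terminal_bits (S :\: D)).
  rewrite /terminal_bits (intersection_order_first injSD (share_of_first shS)) /=.
  by rewrite (negPf ntermSD).
by rewrite cSD /= map_mask -iotaDl [#|D| + 2]addnC.
Qed.

Lemma b_share S r D : starts_inj S -> share_of S r D ->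
    ~~ terminal S r -> (S :\: D == [set r]) || ~~ terminal (S :\: D) r ->
  b S = (b D).+1.
Proof.
move=> injS shS nt ntD; rewrite /b (terminal_labels_share injS shS nt ntD).
have injD : starts_inj D.
  apply: starts_injS injS; apply: subset_trans (share_of_sub shS) _.
  exact: subsetDl.
have := terminal_labels_last injD (share_of_neq0 shS).
case: (terminal_labels D) => //= /esym/eqP.
by rewrite cards_eq0 (negPf (share_of_neq0 shS)).
Qed.

Lemma pairmap_shift c t (s : seq nat) :
  pairmap (fun u v => v - u) (c + t) [seq c + x | x <- s]
    = pairmap (fun u v => v - u) t s.
Proof. by elim: s t => //= x s IH t; rewrite IH subnDl. Qed.

Lemma terminal_labels1 r : terminal_labels [set r] = [:: 1].
Proof.
rewrite /terminal_labels intersection_order1 /= terminal1 /label.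
by rewrite intersection_order1 /= eqxx.
Qed.

Lemma b1 r : b [set r] = 1.
Proof. by rewrite /b terminal_labels1. Qed.

Lemma gaps1 r : gaps [set r] = [::].
Proof. by rewrite /gaps terminal_labels1. Qed.

Lemma size_gaps S : size (gaps S) = (size (terminal_labels S)).-1.
Proof.
by rewrite /gaps; case: terminal_labels => //= t s; rewrite size_pairmap.
Qed.

(** The last label of [D] is |D|, so the junction gap is (|D| + b (S :\: D)) - (1 + |D|). *)
Lemma gaps_share S r D : starts_inj S -> share_of S r D ->
    ~~ terminal S r -> (S :\: D == [set r]) || ~~ terminal (S :\: D) r ->
  gaps S = gaps D ++ if S :\: D == [set r] then [::]
                     else (b (S :\: D) - 1) :: gaps (S :\: D).
Proof.
move=> injS shS nt ntD; rewrite /b /gaps (terminal_labels_share injS shS nt ntD).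
have injD : starts_inj D.
  apply: starts_injS injS; apply: subset_trans (share_of_sub shS) _.
  exact: subsetDl.
have := terminal_labels_last injD (share_of_neq0 shS).
have : terminal_labels (S :\: D) != [::].
  have [rSD _] := share_of_first shS.
  have injSD : starts_inj (S :\: D) by apply: starts_injS injS; apply: subsetDl.
  apply: contraPneq (rSD) => e.
  have := @terminal_labels_last (S :\: D) injSD.
  rewrite e; case: eqP => [->|_ /(_ isT)/esym/eqP]; first by rewrite inE.
  by rewrite cards_eq0 => /eqP ->; rewrite inE.
case: (terminal_labels D) => [_ /= /esym/eqP|t s nSD lastD].
  by rewrite cards_eq0 (negPf (share_of_neq0 shS)).
rewrite /= pairmap_cat pairmap_shift; congr (_ ++ _); case: ifP => // _.
case: (terminal_labels (S :\: D)) nSD => // t' s' _ /=.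
rewrite pairmap_shift -lastD /= last_map.
by congr (_ :: _); lia.
Qed.

(** If [S :\: D] has several chords, the junction gap supplies the middle factor and the exponents
    of [f 0] add up. If it is the root alone, the middle factor is [f 0] and accounts for the one
    extra chord in the exponent. *)
Lemma f_of_share (K : fieldType) (f : nat -> K) S r D :
    starts_inj S -> share_of S r D ->
    ~~ terminal S r -> (S :\: D == [set r]) || ~~ terminal (S :\: D) r ->
  f_of f S = (f_of f (S :\: D) * f (b (S :\: D) - 1)%N * f_of f D)%R.
Proof.
move=> injS shS nt ntD; rewrite /f_of (gaps_share injS shS nt ntD).
have sDS : D \subset S.
  by apply: subset_trans (share_of_sub shS) _; apply: subsetDl.
have injD : starts_inj D by apply: starts_injS injS.
have D0 : 0 < #|D| by rewrite card_gt0 (share_of_neq0 shS).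
(* There are fewer gaps than chords, so the truncated subtractions in the exponents are exact. *)
have szD : size (gaps D) < #|D|.
  by rewrite size_gaps; have := size_terminal_labels injD; lia.
have cS : #|S| = #|S :\: D| + #|D|.
  by rewrite cardsD (setIidPr sDS) subnK // subset_leq_card.
rewrite cS big_cat size_cat /= [RHS]mulrAC; case: ifP => [/eqP->|nSD].
  rewrite big_nil mulr1 gaps1 b1 big_nil cards1 expr0.
  rewrite !mul1r mulrAC -exprSr; congr (_ ^+ _ * _)%R.
  by rewrite addn0 add1n subSn ?(ltnW szD) // !subn1 prednK ?subn_gt0.
have injSD : starts_inj (S :\: D) by apply: starts_injS injS; apply: subsetDl.
have SD0 : 0 < #|S :\: D|.
  by have [rSD _] := share_of_first shS; rewrite card_gt0; apply/set0Pn; exists r.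
have szSD : size (gaps (S :\: D)) < #|S :\: D|.
  by rewrite size_gaps; have := size_terminal_labels injSD; lia.
rewrite big_cons /=.
have -> : #|S :\: D| + #|D| - (size (gaps D) + (size (gaps (S :\: D))).+1) - 1
        = (#|S :\: D| - size (gaps (S :\: D)) - 1) + (#|D| - size (gaps D) - 1).
  by lia.
by rewrite exprD; ring.
Qed.

End TerminalLabels.

(** * Invariance under increasing relabelling of the points *)

Section Relabelling.

Variables (m m' : nat) (h : 'I_m -> 'I_m').
Hypothesis h_mono : forall x y, (h x < h y) = (x < y).
Implicit Types (A B X Y r : chord m) (S T D : {set chord m}).

(** Diagrams with different numbers of points have different types; a strictly increasing map of
    points embeds one into another and preserves crossings, intersection order, labels and
    weights. *)
Definition relabel A : chord m' := (h A.1, h A.2).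

Lemma monotone_leq x y : (h x <= h y) = (x <= y).
Proof. by rewrite leqNgt h_mono -leqNgt. Qed.

Lemma monotone_inj : injective h.
Proof.
by move=> x y e; apply/val_inj/eqP; rewrite eqn_leq -!monotone_leq e leqnn.
Qed.

Lemma relabel_inj : injective relabel.
Proof. by move=> [a c] [a' c'] [] /monotone_inj-> /monotone_inj->. Qed.

Lemma mem_relabel S A : (relabel A \in relabel @: S) = (A \in S).
Proof. exact/mem_imset/relabel_inj. Qed.

Lemma card_relabel S : #|relabel @: S| = #|S|.
Proof. exact/card_imset/relabel_inj. Qed.

Lemma crosses_relabel A B : crosses (relabel A) (relabel B) = crosses A B.
Proof. by rewrite /crosses /= !h_mono. Qed.

Lemma is_endpoint_relabel x A : is_endpoint (h x) (relabel A) = is_endpoint x A.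
Proof. by rewrite /is_endpoint /= !(inj_eq monotone_inj). Qed.

Lemma starts_inj_relabel S : starts_inj S -> starts_inj (relabel @: S).
Proof.
move=> injS _ _ /imsetP[A AS ->] /imsetP[B BS ->] /= /monotone_inj e.
by rewrite (injS A B AS BS e).
Qed.

Lemma relabelD1 S A : (relabel @: S) :\ relabel A = relabel @: (S :\ A).
Proof.
apply/setP => X; rewrite in_setD1; apply/andP/imsetP.
  case=> neXA /imsetP[B BS eX]; exists B => //.
  by rewrite in_setD1 BS andbT; apply: contra neXA => /eqP<-; rewrite eX.
case=> B /setD1P[neBA BS] ->; rewrite mem_relabel BS.
by rewrite (inj_eq relabel_inj).
Qed.

Lemma component_relabel S A : A \in S ->
  component (relabel @: S) (relabel A) = relabel @: component S A.
Proof.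
move=> AS; apply/eqP; rewrite eqEsubset; apply/andP; split.
  apply: component_min; first by rewrite mem_relabel component_self.
  move=> _ _ /imsetP[B BD ->] /imsetP[C CS ->].
  by rewrite crosses_relabel mem_relabel; apply: component_closed.
rewrite sub_imset_pre.
have AK : relabel A \in component (relabel @: S) (relabel A).
  by rewrite component_self ?mem_relabel.
move: (component_closed (S := relabel @: S) (A := relabel A)) AK.
move: (component (relabel @: S) _) => K clK AK.
apply: component_min; first by rewrite inE.
move=> B C; rewrite !inE => BK CS BC.
by apply: clK BK _ _; rewrite ?mem_relabel ?crosses_relabel.
Qed.

Lemma connected_relabel S :
  connected_diagram (relabel @: S) = connected_diagram S.
Proof.
apply/idP/idP => con; apply: connected_intro.
  move=> A T AS AT sTS clT.
  suff /subsetP sST : relabel @: S \subset relabel @: T.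
    by apply/subsetP => X /(imset_f relabel)/sST; rewrite mem_relabel.
  apply: (connected_sub con (imset_f _ AS) (imset_f _ AT)).
  move=> _ _ /imsetP[B BT ->] /imsetP[C CS ->].
  by rewrite crosses_relabel mem_relabel; apply: clT.
move=> _ T /imsetP[A AS ->] AT sTS clT.
rewrite sub_imset_pre; apply: (connected_sub con AS); first by rewrite inE.
move=> B C; rewrite inE => BT CS BC; rewrite inE.
by apply: clT BT _ _; rewrite ?mem_relabel ?crosses_relabel.
Qed.

Lemma ccw_enum_relabel S : starts_inj S ->
  ccw_enum (relabel @: S) = map relabel (ccw_enum S).
Proof.
move=> injS.
apply: (irr_sorted_eq (@ccw_lt_trans m') (@ccw_lt_irr m')).
- exact/ccw_enum_sorted/starts_inj_relabel.
- rewrite sorted_map (@eq_sorted _ _ (@ccw_lt m)) ?ccw_enum_sorted //.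
  by move=> A B; apply: h_mono.
move=> X; rewrite mem_ccw_enum; apply/imsetP/mapP => -[A AS ->]; exists A => //;
  by move: AS; rewrite mem_ccw_enum.
Qed.

Lemma components_relabel S : starts_inj S ->
  components (relabel @: S)
    = [seq relabel @: D | D : {set chord m} <- components S].
Proof.
move=> injS; rewrite !componentsE ccw_enum_relabel // filter_map -!map_comp.
have -> : [seq A <- ccw_enum S | leads_component (relabel @: S) (relabel A)]
        = [seq A <- ccw_enum S | leads_component S A].
  apply: eq_in_filter => A; rewrite mem_ccw_enum => AS.
  rewrite /leads_component component_relabel //.
  apply/forall_inP/forall_inP => lead.
    by move=> B BD; have := lead _ (imset_f _ BD); rewrite /ccw_le monotone_leq.
  by move=> _ /imsetP[B BD ->]; rewrite /ccw_le monotone_leq; apply: lead.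
apply/eq_in_map => A; rewrite mem_filter mem_ccw_enum => /andP[_ AS].
exact: component_relabel.
Qed.

Lemma intersection_order_rec_relabel d S : starts_inj S ->
  intersection_order_rec d (relabel @: S)
    = map relabel (intersection_order_rec d S).
Proof.
elim: d S => //= d IH S injS; rewrite ccw_enum_relabel //.
case: (ccw_enum S) => //= r _.
have injSr : starts_inj (S :\ r) by apply: starts_injS injS; apply: subsetDl.
rewrite relabelD1 components_relabel // -map_comp map_flatten -map_comp.
congr (_ :: flatten _); apply/eq_in_map => D /components_sub sD /=.
by rewrite IH //; apply: starts_injS injSr.
Qed.

Lemma terminal_relabel S A : terminal (relabel @: S) (relabel A) = terminal S A.
Proof.
apply/forall_inP/forall_inP => term.
  move=> B BS; have := term _ (imset_f _ BS).
  by rewrite /ccw_lt h_mono crosses_relabel.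
move=> _ /imsetP[B BS ->]; rewrite /ccw_lt h_mono crosses_relabel.
exact: term.
Qed.

Lemma terminal_labels_relabel S : starts_inj S ->
  terminal_labels (relabel @: S) = terminal_labels S.
Proof.
move=> injS; rewrite !terminal_labelsE //; last exact: starts_inj_relabel.
rewrite /terminal_bits /intersection_order card_relabel.
rewrite intersection_order_rec_relabel // -map_comp.
by congr mask; apply: eq_map => A; apply: terminal_relabel.
Qed.

Lemma b_relabel S : starts_inj S -> b (relabel @: S) = b S.
Proof. by move=> injS; rewrite /b terminal_labels_relabel. Qed.

Lemma f_of_relabel (K : fieldType) (f : nat -> K) S : starts_inj S ->
  f_of f (relabel @: S) = f_of f S.
Proof.
by move=> injS; rewrite /f_of /gaps terminal_labels_relabel // card_relabel.
Qed.

End Relabelling.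

(** * The root share of a connected diagram *)

Section ConnectedShare.

Variable m : nat.
Implicit Types (A B X Y r : chord m) (S T D : {set chord m}).

(** Otherwise the component would be closed in all of [S], and connectedness would force it to
    contain [r]. *)
Lemma component_crosses_root S r X : connected_diagram S -> r \in S ->
  X \in S :\ r -> exists2 Y, Y \in component (S :\ r) X & crosses r Y.
Proof.
move=> conS rS XSr; apply/exists_inP; apply: contraT => /exists_inPn noY.
have /setD1P[_ XS] := XSr.
have /subsetP/(_ r rS) : S \subset component (S :\ r) X.
  apply: (connected_sub conS XS); first exact: component_self.
  move=> B C BD CS BC; have [eC|neC] := eqVneq C r.
    by have := noY B BD; rewrite crossesC -eC BC.
  by apply: component_closed BD _ BC; rewrite in_setD1 neC.
by move/(subsetP (component_sub _ _)); rewrite in_setD1 eqxx.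
Qed.

Lemma root_not_terminal S r : starts_inj S -> connected_diagram S ->
  first_chord S r -> S != [set r] -> ~~ terminal S r.
Proof.
move=> injS conS firstr neSr; have [rS _] := firstr.
have [X XSr] : exists X, X \in S :\ r.
  apply/set0Pn; apply: contra neSr => /eqP Sr0.
  by rewrite -(setD1K rS) Sr0 setU0.
have [Y YD rY] := component_crosses_root conS rS XSr.
have /setD1P[neYr YS] := subsetP (component_sub _ _) Y YD.
apply/forall_inP => /(_ Y YS); rewrite rY implybF => /negP; apply.
exact: first_chord_lt firstr YS neYr.
Qed.

Lemma share_connected S r D : share_of S r D -> connected_diagram D.
Proof. by case=> A [_ _ ->]; apply: component_connected. Qed.

Lemma share_compl_connected S r D : connected_diagram S -> share_of S r D ->
  connected_diagram (S :\: D).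
Proof.
move=> conS shS; have [A [[rS _] _ eD]] := shS.
have closeD B C : B \in D -> C \in S -> crosses B C -> C != r -> C \in D.
  rewrite eD => BD CS BC neCr; apply: component_closed BD _ BC.
  by rewrite in_setD1 neCr.
apply: connected_intro => X T /setDP[XS _] XT /subsetP sT clT.
(* A closed part avoiding [r] would be closed in [S] as well, since only [r] can link [S :\: D] to
   [D]. *)
have rT : r \in T.
  apply/negPn/negP => nrT; move/negP: (nrT); apply.
  apply: (subsetP (connected_sub conS XS XT _)) => // B C BT CS BC.
  apply: (clT B) => //; rewrite inE CS andbT; apply/negP => CD.
  have /setDP[BS /negP BD] := sT B BT.
  apply: BD; apply: closeD CD BS _ _; first by rewrite crossesC.
  by apply: contraNneq nrT => <-.
(* Now that [r] is in [T], the union [T :|: D] is closed in [S]. *)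
have sSTD : S \subset T :|: D.
  apply: (connected_sub conS XS); first by rewrite inE XT.
  move=> B C; rewrite !in_setU => BTD CS BC.
  have [CD|CD] := boolP (C \in D); first by rewrite orbT.
  rewrite orbF; case/orP: BTD => [BT|BD].
    by apply: clT BT _ BC; rewrite inE CS CD.
  have [-> //|neCr] := eqVneq C r.
  by rewrite (closeD B C) in CD.
apply/subsetP => Y /setDP[YS YD].
by have := subsetP sSTD Y YS; rewrite in_setU (negPf YD) orbF.
Qed.

(** Connectedness yields the side conditions of [terminal_labels_share] and its consequences. *)
Lemma connected_share_roots S r D : starts_inj S -> connected_diagram S ->
  share_of S r D ->
  ~~ terminal S r /\ (S :\: D == [set r]) || ~~ terminal (S :\: D) r.
Proof.
move=> injS conS shS; have [A [firstr [ASr _] _]] := shS; split.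
  apply: root_not_terminal => //.
  by apply: contraTneq ASr => ->; rewrite setDv inE.
case: eqP => //= /eqP neSDr.
apply: root_not_terminal neSDr; [|exact: share_compl_connected shS|].
  by apply: starts_injS injS; apply: subsetDl.
exact: share_of_first shS.
Qed.

(** The functional form of [share_of], used to partition sums by the size and the position of the
    share. *)
Definition share S : {set chord m} :=
  if ccw_enum S is r :: _ then head set0 (components (S :\ r)) else set0.

Lemma shareE S r D : starts_inj S -> share_of S r D -> share S = D.
Proof.
move=> injS [A [firstr firstA ->]]; rewrite /share (ccw_enum_first injS firstr).
rewrite (components_first _ firstA) //.
by apply: starts_injS injS; apply: subsetDl.
Qed.

Lemma share_ofP S : starts_inj S -> 1 < #|S| -> exists r D, share_of S r D.
Proof.
move=> injS S1; have [|r firstr] := @first_chordP _ S.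
  by rewrite -card_gt0; apply: ltnW.
have [rS _] := firstr.
have [|A firstA] := @first_chordP _ (S :\ r).
  by rewrite -card_gt0; move: S1; rewrite (cardsD1 r) rS.
by exists r, (component (S :\ r) A), A.
Qed.

End ConnectedShare.

(** * Perfect matchings and their endpoints *)

Section Matchings.

Variable m : nat.
Implicit Types (A B X Y r : chord m) (S T D : {set chord m}).

Definition matching S := {in S, forall A, A.1 < A.2} /\
  (forall p, {in S &, forall A B, is_endpoint p A -> is_endpoint p B -> A = B}).

Definition endpoints S : {set 'I_m} :=
  [set p | [exists A in S, is_endpoint p A]].

Lemma endpointsP S p :
  reflect (exists2 A, A \in S & is_endpoint p A) (p \in endpoints S).
Proof. by rewrite inE; apply: exists_inP. Qed.

Lemma perfect_matchingP S :
  reflect (matching S /\ endpoints S = setT) (perfect_matching S).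
Proof.
apply: (iffP andP) => [[/forall_inP lt12 /forallP card1]|[[lt12 inj] full]].
  split; first split=> // p A B AS BS pA pB.
    have /cards1P[C eC] := card1 p.
    have : A \in [set C] by rewrite -eC inE AS.
    have : B \in [set C] by rewrite -eC inE BS.
    by move=> /set1P-> /set1P->.
  apply/setP => p; rewrite in_setT; apply/endpointsP.
  have /cards1P[C eC] := card1 p.
  have := set11 C; rewrite -eC inE => /andP[CS pC].
  by exists C.
split; first exact/forall_inP.
apply/forallP => p; have : p \in endpoints S by rewrite full in_setT.
case/endpointsP => A AS pA; apply/cards1P; exists A; apply/setP => B.
rewrite !inE; apply/andP/eqP => [[BS pB]|->] //.
exact: inj pB pA.
Qed.

Lemma matchingS S T : T \subset S -> matching S -> matching T.
Proof.
move=> /subsetP sTS [lt12 inj]; split=> [A /sTS/lt12 //|p A B /sTS AS /sTS BS].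
exact: inj.
Qed.

Lemma matching_starts_inj S : matching S -> starts_inj S.
Proof.
move=> [_ inj] A B AS BS /= e; apply: (inj A.1) => //; rewrite /is_endpoint ?eqxx //.
by rewrite e eqxx.
Qed.

Lemma card_endpoints S : matching S -> #|endpoints S| = #|S|.*2.
Proof.
move=> mS; have [lt12 inj] := mS.
have -> : endpoints S = [set A.1 | A in S] :|: [set A.2 | A in S].
  apply/setP => p; rewrite in_setU; apply/endpointsP/orP.
    by case=> A AS /orP[/eqP->|/eqP->]; [left|right]; apply: imset_f.
  by case=> /imsetP[A AS ->]; exists A => //; rewrite /is_endpoint eqxx ?orbT.
rewrite cardsU (_ : _ :&: _ = set0) ?cards0 ?subn0; last first.
  apply/setP => p; rewrite in_setI in_set0; apply/negP.
  case/andP=> /imsetP[A AS eA] /imsetP[B BS eB].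
  have e : A = B.
    apply: (inj p) => //; rewrite /is_endpoint; first by rewrite eA eqxx.
    by rewrite eB eqxx orbT.
  by have := lt12 A AS; rewrite -eA eB e ltnn.
rewrite !card_in_imset ?addnn // => A B AS BS /= e.
  apply: (inj A.2) => //; rewrite /is_endpoint ?eqxx ?orbT //.
  by rewrite e eqxx orbT.
exact: (matching_starts_inj mS).
Qed.

Lemma perfect_first S r : perfect_matching S -> first_chord S r -> r.1 = 0 :> nat.
Proof.
case/perfect_matchingP => [[lt12 _] full] [rS minr].
have r1m := ltn_ord r.1.
have m0 : 0 < m by lia.
have : Ordinal m0 \in endpoints S by rewrite full in_setT.
case/endpointsP => A AS; have := lt12 A AS; have := minr A AS; rewrite /ccw_le.
move=> rA A12 /orP[/eqP e|/eqP e]; move: (congr1 (@nat_of_ord m) e) => /= {}e.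
  by apply/eqP; rewrite -leqn0 e.
by rewrite -e in A12.
Qed.

Lemma perfect_root S : 0 < m -> perfect_matching S ->
  exists2 r, first_chord S r & r.1 = 0 :> nat.
Proof.
move=> m0 pS; have [|r firstr] := @first_chordP _ S; last first.
  by exists r => //; apply: perfect_first pS firstr.
have /perfect_matchingP[_ full] := pS.
have : Ordinal m0 \in endpoints S by rewrite full in_setT.
by case/endpointsP => A AS _; apply/set0Pn; exists A.
Qed.

End Matchings.

Lemma perfect_card n (S : {set chord n.*2}) : perfect_matching S -> #|S| = n.
Proof.
case/perfect_matchingP => mS full; apply: double_inj.
by rewrite -card_endpoints // full cardsT card_ord.
Qed.

Lemma RCCD_facts n (C : {set chord n.*2}) : C \in RCCD n ->
  [/\ 0 < n, perfect_matching C, connected_diagram C, starts_inj C & #|C| = n].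
Proof.
rewrite inE => /and3P[n0 pC conC]; split=> //; last exact: perfect_card.
by have /perfect_matchingP[/matching_starts_inj] := pC.
Qed.

(** * Gluing two diagrams at a gap, and the inverse operation *)

Section Gluing.

Variables n1 n2 i : nat.
Hypotheses (n1_gt0 : 0 < n1) (i_gt0 : 0 < i) (lt_i : i < n2.*2).

Local Notation N := (n1 + n2).*2.
Implicit Types (A : {set chord n1.*2}) (B : {set chord n2.*2}).
Implicit Types (C : {set chord N}) (p : 'I_N) (x : 'I_n1.*2) (y : 'I_n2.*2).

(* The root point of the first diagram stays in front; its other points fill *)
(* the gap of the second diagram lying after the first [i] points. *)
Fact inner_subproof x : (if x == 0 :> nat then 0 else x + i) < N.
Proof. by have := ltn_ord x; case: eqVneq; lia. Qed.

Fact outer_subproof y : (if y < i then y.+1 else y + n1.*2) < N.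
Proof. by have := ltn_ord y; case: (ltnP y i); lia. Qed.

Definition inner x : 'I_N := Ordinal (inner_subproof x).
Definition outer y : 'I_N := Ordinal (outer_subproof y).

Lemma inner_mono x x' : (inner x < inner x') = (x < x').
Proof.
by rewrite /=; case: (eqVneq (x : nat) 0); case: (eqVneq (x' : nat) 0); lia.
Qed.

Lemma outer_mono y y' : (outer y < outer y') = (y < y').
Proof. by rewrite /=; case: (ltnP y i); case: (ltnP y' i); lia. Qed.

(** The places of the 2 n1 - 1 non-root points of the first diagram. The root point 0 is neither in
    the gap nor an [outer_point]. *)
Definition in_gap (p : nat) := i < p < i + n1.*2.

Definition outer_point (p : nat) := (0 < p) && ~~ in_gap p.

Lemma inner_in_gap x : 0 < x -> in_gap (inner x).
Proof. by have := ltn_ord x; rewrite /in_gap /=; case: eqVneq; lia. Qed.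

Lemma inner_point x : outer_point (inner x) = false.
Proof.
by have := ltn_ord x; rewrite /outer_point /in_gap /=; case: eqVneq; lia.
Qed.

Lemma outer_pointE y : outer_point (outer y).
Proof.
by have := ltn_ord y; rewrite /outer_point /in_gap /=; case: (ltnP y i); lia.
Qed.

Lemma outer_pointP p : outer_point p -> exists y, p = outer y.
Proof.
move=> outp; have ltp : (if p <= i then p.-1 else p - n1.*2) < n2.*2.
  have := ltn_ord p; move: outp; rewrite /outer_point /in_gap.
  by case: (leqP p i); lia.
exists (Ordinal ltp); apply: val_inj => /=.
move: outp; rewrite /outer_point /in_gap; case: (leqP p i) => ?.
  by case: (ltnP p.-1 i); lia.
by case: (ltnP (p - n1.*2) i); lia.
Qed.

Lemma inner_pointP p : ~~ outer_point p -> exists x, p = inner x.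
Proof.
move=> outp; have ltp : (if p == 0 :> nat then 0 else p - i) < n1.*2.
  have := ltn_ord p; move: outp; rewrite /outer_point /in_gap.
  by case: (eqVneq (p : nat) 0); lia.
exists (Ordinal ltp); apply: val_inj => /=.
move: outp; rewrite /outer_point /in_gap; case: (eqVneq (p : nat) 0) => [->|?] //.
by case: (eqVneq (p - i) 0); lia.
Qed.

Notation relI := (relabel inner).
Notation relO := (relabel outer).

Lemma relI_neq_relO X Y : relI X != relO Y.
Proof.
apply: contraFneq (inner_point X.1) => e.
by have := outer_pointE Y.1; rewrite (congr1 fst e : inner X.1 = outer Y.1).
Qed.

Definition glue A B : {set chord N} := relI @: A :|: relO @: B.

(** Preimages drop any chord joining an inner point to an outer one; [unglueP] gives conditions
    under which no chord is lost. *)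
Definition unglue C : {set chord n1.*2} * {set chord n2.*2} :=
  (relI @^-1: C, relO @^-1: C).

Lemma relI_glue A B X : (relI X \in glue A B) = (X \in A).
Proof.
rewrite in_setU (mem_relabel inner_mono); case: (X \in A) => //=.
by apply/negP => /imsetP[Y _ e]; have := relI_neq_relO X Y; rewrite e eqxx.
Qed.

Lemma relO_glue A B Y : (relO Y \in glue A B) = (Y \in B).
Proof.
rewrite in_setU (mem_relabel outer_mono) orbC; case: (Y \in B) => //=.
by apply/negP => /imsetP[X _ e]; have := relI_neq_relO X Y; rewrite e eqxx.
Qed.

Lemma glueK A B : unglue (glue A B) = (A, B).
Proof.
congr pair; apply/setP => X; rewrite inE; first exact: relI_glue.
exact: relO_glue.
Qed.

Lemma glueP A B Z : Z \in glue A B ->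
  (exists2 X, X \in A & Z = relI X) \/ (exists2 Y, Y \in B & Z = relO Y).
Proof. by case/setUP => /imsetP[X]; [left|right]; exists X. Qed.

Lemma matching_glue A B : matching A -> matching B -> matching (glue A B).
Proof.
move=> [lt1 inj1] [lt2 inj2]; split.
  by move=> Z /glueP[[X /lt1 ltX ->]|[Y /lt2 ltY ->]];
    rewrite ?inner_mono ?outer_mono.
have nIO p X Y : is_endpoint p (relI X) -> is_endpoint p (relO Y) -> False.
  move=> pX pY; have : outer_point p.
    by case/orP: pY => /eqP->; apply: outer_pointE.
  by case/orP: pX => /eqP->; rewrite [outer_point _]inner_point.
move=> p Z Z' /glueP[[X XA ->]|[Y YB ->]] /glueP[[X' XA' ->]|[Y' YB' ->]] pZ pZ'.
- have [x ex] : exists x, p = inner x by case/orP: pZ => /eqP->; eexists.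
  move: pZ pZ'; rewrite ex !(is_endpoint_relabel inner_mono) => xX xX'.
  by rewrite (inj1 x X X').
- by case: (nIO p X Y').
- by case: (nIO p X' Y).
- have [y ey] : exists y, p = outer y by case/orP: pZ => /eqP->; eexists.
  move: pZ pZ'; rewrite ey !(is_endpoint_relabel outer_mono) => yY yY'.
  by rewrite (inj2 y Y Y').
Qed.

Lemma endpoints_relO B : endpoints B = setT ->
  forall p, (p \in endpoints (relO @: B)) = outer_point p.
Proof.
move=> full p; apply/endpointsP/idP.
  by case=> _ /imsetP[Y _ ->] /orP[/eqP->|/eqP->]; apply: outer_pointE.
case/outer_pointP => y ->; have : y \in endpoints B by rewrite full in_setT.
case/endpointsP => Y YB yY; exists (relO Y); first exact: imset_f.
by rewrite (is_endpoint_relabel outer_mono).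
Qed.

Lemma perfect_glue A B : perfect_matching A -> perfect_matching B ->
  perfect_matching (glue A B).
Proof.
move=> /perfect_matchingP[mA fullA] /perfect_matchingP[mB fullB].
apply/perfect_matchingP; split; first exact: matching_glue.
apply/setP => p; rewrite in_setT; apply/endpointsP.
have [outp|outp] := boolP (outer_point p).
  move: outp; rewrite -(endpoints_relO fullB) => /endpointsP[Z ZB pZ].
  by exists Z => //; rewrite in_setU ZB orbT.
have [x ->] := inner_pointP outp.
have : x \in endpoints A by rewrite fullA in_setT.
case/endpointsP => X XA xX; exists (relI X); first by rewrite relI_glue.
by rewrite (is_endpoint_relabel inner_mono).
Qed.

Lemma crosses_gap_nat a c u v : in_gap a -> in_gap c ->
  outer_point u -> outer_point v ->
  ([&& a < u, u < c & c < v] || [&& u < a, a < v & v < c]) = false.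
Proof. by rewrite /outer_point /in_gap; lia. Qed.

Lemma crosses_relI_relO (X : chord n1.*2) (Y : chord n2.*2) :
  0 < X.1 -> 0 < X.2 -> crosses (relI X) (relO Y) = false.
Proof.
move=> X1 X2; apply: crosses_gap_nat; rewrite ?inner_in_gap //;
  exact: outer_pointE.
Qed.

(** Otherwise the chords lying before the gap would be closed under crossing; they include the root
    but not the chord at the last point. *)
Lemma straddling_chord B : perfect_matching B -> connected_diagram B ->
  exists2 Y, Y \in B & Y.1 < i <= Y.2.
Proof.
move=> pB conB; have /perfect_matchingP[[lt12 _] full] := pB.
apply/exists_inP; apply: contraT => /exists_inPn noY.
have n2_gt0 : 0 < n2.*2 by apply: leq_ltn_trans lt_i.
have [r [rB _] r1] := perfect_root n2_gt0 pB.
have leftP X : X \in B -> X.1 < i -> X.2 < i.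
  by move=> XB X1; have := noY X XB; rewrite X1 /= -ltnNge.
have sB : B \subset [set X in B | X.2 < i].
  apply: (connected_sub conB rB); first by rewrite inE rB leftP // r1.
  move=> X Z; rewrite inE => /andP[XB X2] ZB XZ; rewrite inE ZB leftP //.
  case/orP: XZ => /and3P[lt1 lt2 lt3]; first exact: ltn_trans X2.
  by apply: ltn_trans lt1 _; apply: ltn_trans (lt12 X XB) X2.
have lt_last : (n2.*2).-1 < n2.*2 by rewrite prednK.
have : Ordinal lt_last \in endpoints B by rewrite full in_setT.
case/endpointsP => Z ZB pZ; have := subsetP sB Z ZB; rewrite inE ZB /= => Z2.
have Z1 := ltn_trans (lt12 Z ZB) Z2.
by case/orP: pZ => /eqP/(congr1 val) /= e; [move: Z1|move: Z2]; rewrite -e; lia.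
Qed.

(** The root of [B] lands at point 1, just after the root point, so its component comes first; the
    non-root chords of [A] stay within the gap and cross nothing of [B]. *)
Lemma glue_share A B : A \in RCCD n1 -> B \in RCCD n2 ->
  exists r, share_of (glue A B) r (relO @: B).
Proof.
move=> /RCCD_facts[_ pA conA _ _] /RCCD_facts[n2_gt0 pB conB _ _].
have pG := perfect_glue pA pB.
have /perfect_matchingP[/matching_starts_inj injG _] := pG.
have /perfect_matchingP[[lt12 injA] _] := pA.
have [|rA [rAA minA] rA1] := perfect_root _ pA; first by rewrite double_gt0.
have [|rB [rBB minB] rB1] := perfect_root _ pB; first by rewrite double_gt0.
have rI1 : (relI rA).1 = 0 :> nat by rewrite /= rA1.
have rO1 : (relO rB).1 = 1 :> nat by rewrite /= rB1 i_gt0.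
have rG : relI rA \in glue A B by rewrite relI_glue.
have inGr Y : Y \in B -> relO Y \in glue A B :\ relI rA.
  by move=> YB; rewrite in_setD1 relO_glue YB andbT eq_sym relI_neq_relO.
exists (relI rA), (relO rB); split.
- by split=> // Z _; rewrite /ccw_le rI1.
- split=> [|Z /setD1P[neZ ZG]]; first exact: inGr.
  rewrite /ccw_le rO1 lt0n; apply: contra neZ => /eqP Z1.
  by apply/eqP/injG => //; apply: val_inj; rewrite [RHS]rI1.
apply/eqP; rewrite eqEsubset; apply/andP; split.
  apply: (@connected_sub _ _ _ (relO rB)).
  - by rewrite (connected_relabel outer_mono).
  - exact: imset_f.
  - exact/component_self/inGr.
  move=> Z W ZD /imsetP[Y YB ->] ZW.
  by apply: component_closed ZD _ ZW; apply: inGr.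
apply: component_min; first exact: imset_f.
move=> _ W /imsetP[Y YB ->] /setD1P[neW].
case/glueP => [[X XA eW]|[Y' YB' ->]]; last by move=> _; apply: imset_f.
have neX : X != rA by apply: contraNneq neW => <-; rewrite eW.
have X1 : 0 < X.1.
  rewrite lt0n; apply: contra neX => /eqP X1; apply/eqP.
  apply: (injA X.1) => //; rewrite /is_endpoint ?eqxx //.
  by apply/orP; left; apply/eqP/val_inj; rewrite /= X1 rA1.
rewrite eW crossesC crosses_relI_relO //.
exact: ltn_trans X1 (lt12 X XA).
Qed.

(** The two connected images are linked: the root chord of [A] ends in the gap, and so crosses the
    chord of [B] that straddles it. *)
Lemma glue_RCCD A B : A \in RCCD n1 -> B \in RCCD n2 ->
  glue A B \in RCCD (n1 + n2).
Proof.
move=> /RCCD_facts[_ pA conA _ _] /RCCD_facts[n2_gt0 pB conB _ _].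
rewrite inE addn_gt0 n1_gt0 /= perfect_glue //=.
have [|rA [rAA minA] rA1] := perfect_root _ pA; first by rewrite double_gt0.
have [Y YB Yi] := straddling_chord pB conB.
have XY : crosses (relI rA) (relO Y).
  have /perfect_matchingP[[lt12 _] _] := pA; have := lt12 rA rAA.
  have := ltn_ord rA.2; case/andP: Yi => Y1 Y2.
  have Y2' : (Y.2 < i) = false by rewrite ltnNge Y2.
  rewrite /crosses /= rA1 eqxx Y1 Y2' /=.
  move: (nat_of_ord rA.2) (nat_of_ord Y.1) (nat_of_ord Y.2) Y1 Y2 => a u v.
  by case: (eqVneq a 0); lia.
apply: connected_intro => Z T ZG ZT _ clT.
have sA X : X \in A -> relI X \in T -> relI @: A \subset T.
  move=> XA XT; apply: (connected_sub _ (imset_f _ XA) XT).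
    by rewrite (connected_relabel inner_mono).
  by move=> V W VT WA; apply: clT => //; rewrite in_setU WA.
have sB X : X \in B -> relO X \in T -> relO @: B \subset T.
  move=> XB XT; apply: (connected_sub _ (imset_f _ XB) XT).
    by rewrite (connected_relabel outer_mono).
  by move=> V W VT WB; apply: clT => //; rewrite in_setU WB orbT.
rewrite subUset; case/glueP: ZG => [[X XA eZ]|[X XB eZ]]; rewrite eZ in ZT.
  have sAT := sA X XA ZT; rewrite sAT; apply: (sB Y YB).
  apply: clT XY; last by rewrite relO_glue.
  by apply: (subsetP sAT); apply: imset_f.
have sBT := sB X XB ZT; rewrite sBT andbT; apply: (sA rA rAA).
apply: (clT (relO Y)); last by rewrite crossesC.
  by apply: (subsetP sBT); apply: imset_f.
by rewrite relI_glue.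
Qed.

Definition in_position C :=
  [forall p, (p \in endpoints (share C)) == outer_point p].

(** By [in_position], chords of the share have only outer endpoints and all other chords only inner
    ones, so every chord is the image of a chord of one of the two diagrams. *)
Lemma unglueP C : C \in RCCD (n1 + n2) -> 1 < #|C| -> #|share C| = n2 ->
    in_position C ->
  [/\ (unglue C).1 \in RCCD n1, (unglue C).2 \in RCCD n2,
      relI @: (unglue C).1 = C :\: share C & relO @: (unglue C).2 = share C].
Proof.
move=> CR C1 cD /forallP posC; have [_ pC conC injC cC] := RCCD_facts CR.
have [r [D shC]] := share_ofP injC C1.
rewrite (shareE injC shC) in cD posC *.
have [mC fullC] := perfect_matchingP _ pC; have [lt12 inj] := mC.
have sDC : D \subset C.
  by apply: subset_trans (share_of_sub shC) _; apply: subsetDl.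
have outD X p : X \in D -> is_endpoint p X -> outer_point p.
  by move=> XD pX; rewrite -(eqP (posC p)); apply/endpointsP; exists X.
have innCD X p : X \in C -> X \notin D -> is_endpoint p X -> ~~ outer_point p.
  move=> XC XD pX; rewrite -(eqP (posC p)); apply/endpointsP => -[Y YD pY].
  by move/negP: XD; apply; rewrite (inj p X Y) // (subsetP sDC).
have ends (X : chord N) : is_endpoint X.1 X /\ is_endpoint X.2 X.
  by rewrite /is_endpoint !eqxx orbT.
have eI : relI @: (unglue C).1 = C :\: D.
  apply/setP => Z; apply/imsetP/setDP.
    case=> X; rewrite inE => XC ->; split=> //; apply/negP => /outD.
    by case: (ends (relI X)) => e1 _ /(_ _ e1); rewrite [outer_point _]inner_point.
  case=> ZC ZD; have [e1 e2] := ends Z.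
  have [x1 ex1] := inner_pointP (innCD Z _ ZC ZD e1).
  have [x2 ex2] := inner_pointP (innCD Z _ ZC ZD e2).
  have eZ : Z = relI (x1, x2) by rewrite /relabel -ex1 -ex2; case: (Z).
  by exists (x1, x2); rewrite // inE -eZ.
have eO : relO @: (unglue C).2 = D.
  apply/setP => Z; apply/imsetP/idP.
    case=> X; rewrite inE => XC ->; apply: contraT => /(innCD _ _ XC).
    by case: (ends (relO X)) => e1 _ /(_ _ e1); rewrite [outer_point _]outer_pointE.
  move=> ZD; have [e1 e2] := ends Z.
  have [x1 ex1] := outer_pointP (outD Z _ ZD e1).
  have [x2 ex2] := outer_pointP (outD Z _ ZD e2).
  have eZ : Z = relO (x1, x2) by rewrite /relabel -ex1 -ex2; case: (Z).
  by exists (x1, x2); rewrite // inE -eZ (subsetP sDC).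
have n2_gt0 : 0 < n2 by rewrite -double_gt0; apply: leq_ltn_trans lt_i.
split=> //; rewrite inE ?n1_gt0 ?n2_gt0 /=; apply/andP; split.
- apply/perfect_matchingP; split; last first.
    apply/setP => x; rewrite in_setT; apply/endpointsP.
    have : inner x \in endpoints C by rewrite fullC in_setT.
    case/endpointsP => Z ZC xZ; have : Z \in C :\: D.
      rewrite inE ZC andbT; apply/negP => /outD/(_ xZ).
      by rewrite inner_point.
    rewrite -eI => /imsetP[X XA eZ]; exists X => //.
    by move: xZ; rewrite eZ (is_endpoint_relabel inner_mono).
  split=> [X|x X Y]; rewrite inE; first by move/lt12; rewrite inner_mono.
  move=> XC; rewrite inE => YC xX xY; apply: (relabel_inj inner_mono).
  by apply: (inj (inner x)); rewrite ?(is_endpoint_relabel inner_mono).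
- rewrite -(connected_relabel inner_mono) [relI @: _]eI.
  exact: share_compl_connected shC.
- apply/perfect_matchingP; split; last first.
    apply/setP => x; rewrite in_setT; apply/endpointsP.
    have : outer x \in endpoints C by rewrite fullC in_setT.
    case/endpointsP => Z ZC xZ; have : Z \in D.
      by apply: contraT => /(innCD _ _ ZC)/(_ xZ); rewrite outer_pointE.
    rewrite -eO => /imsetP[X XA eZ]; exists X => //.
    by move: xZ; rewrite eZ (is_endpoint_relabel outer_mono).
  split=> [X|x X Y]; rewrite inE; first by move/lt12; rewrite outer_mono.
  move=> XC; rewrite inE => YC xX xY; apply: (relabel_inj outer_mono).
  by apply: (inj (outer x)); rewrite ?(is_endpoint_relabel outer_mono).
- rewrite -(connected_relabel outer_mono) [relO @: _]eO.
  exact: share_connected shC.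
Qed.

End Gluing.

Lemma card_interval N a c : a <= c -> c < N ->
  #|[set p : 'I_N | a <= p <= c]| = (c - a).+1.
Proof.
move=> le_ac lt_cN.
have ltN (j : 'I_(c - a).+1) : a + j < N by have := ltn_ord j; lia.
have -> : [set p : 'I_N | a <= p <= c] = [set Ordinal (ltN j) | j in setT].
  apply/setP => p; rewrite inE; apply/idP/imsetP => [ap|[j _ ->] /=].
    have ltj : p - a < (c - a).+1 by lia.
    by exists (Ordinal ltj) => //; apply: val_inj => /=; lia.
  by have := ltn_ord j; lia.
rewrite card_imset ?cardsT ?card_ord // => j j' /(congr1 val) /= e.
by apply: val_inj => /=; lia.
Qed.

(** * The complement of the share lies in a single gap *)

Section SharePosition.

Variable m : nat.
Implicit Types (A B X Y Z W r : chord m) (S T D : {set chord m}).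

Definition outside X (p : nat) := (p < X.1) || (X.2 < p).

(** Crossing on bare numbers. The facts that follow are the arithmetic of passing from one chord to
    a chord that crosses it. *)
Let cross_nat a c u v := [&& a < u, u < c & c < v] || [&& u < a, a < v & v < c].

Fact outside_step_nat a c u v u' v' : a < c -> u < v -> u' < v' ->
    u' != a -> u' != c -> v' != a -> v' != c ->
    ~~ cross_nat a c u' v' -> cross_nat u v u' v' ->
    ((u < a) || (c < u)) && ((v < a) || (c < v)) ->
  ((u' < a) || (c < u')) && ((v' < a) || (c < v')).
Proof. by rewrite /cross_nat; lia. Qed.

Fact outside_start_nat a c u v : a < c -> u < v -> v != a -> v != c -> u < a ->
    ~~ cross_nat a c u v ->
  ((u < a) || (c < u)) && ((v < a) || (c < v)).
Proof. by rewrite /cross_nat; lia. Qed.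

Fact left_step_nat p a c u v : a < c -> u < v ->
    (p < a) || (c < p) -> (p < u) || (v < p) -> cross_nat a c u v ->
  (p < u) = (p < a).
Proof. by rewrite /cross_nat; lia. Qed.

Lemma matching_neq S X Y : matching S -> X \in S -> Y \in S -> X != Y ->
  [/\ Y.1 != X.1 :> nat, Y.1 != X.2 :> nat, Y.2 != X.1 :> nat & Y.2 != X.2 :> nat].
Proof.
move=> [_ inj] XS YS neXY.
have disj p q : is_endpoint p X -> is_endpoint q Y -> q != p :> nat.
  move=> pX qY; apply: contra neXY => /eqP/val_inj eqp.
  by apply/eqP/(inj p) => //; rewrite -eqp.
by split; apply: disj; rewrite /is_endpoint eqxx ?orbT.
Qed.

(** A chord that meets a chord outside [X] but does not cross [X] is itself outside [X]; starting
    from [A], this spreads over the connected set [D]. *)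
Lemma outside_component S D X A Z : matching S -> D \subset S -> X \in S ->
    X \notin D -> connected_diagram D -> {in D, forall Y, ~~ crosses X Y} ->
    A \in D -> A.1 < X.1 -> Z \in D ->
  outside X Z.1 && outside X Z.2.
Proof.
move=> mS /subsetP sDS XS XD conD ncX AD ltAX ZD.
have [lt12 _] := mS.
have neX Y : Y \in D -> [/\ Y.1 != X.1 :> nat, Y.1 != X.2 :> nat,
                            Y.2 != X.1 :> nat & Y.2 != X.2 :> nat].
  move=> YD; apply: (matching_neq mS) => //; first exact: sDS.
  by apply: contraNneq XD => ->.
suff /subsetP/(_ Z ZD) : D \subset [set Y in D | outside X Y.1 && outside X Y.2].
  by rewrite inE => /andP[].
apply: (connected_sub conD AD).
  rewrite inE AD; have [_ _ n1 n2] := neX A AD.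
  exact: (outside_start_nat (lt12 X XS) (lt12 A (sDS A AD)) n1 n2 ltAX (ncX A AD)).
move=> Y W; rewrite inE => /andP[YD outY] WD YW; rewrite inE WD.
have [n1 n2 n3 n4] := neX W WD.
exact: (outside_step_nat (lt12 X XS) (lt12 Y (sDS Y YD)) (lt12 W (sDS W WD))
  n1 n2 n3 n4 (ncX W WD) YW outY).
Qed.

(** Crossing chords have overlapping spans, so a point lying in neither span cannot separate
    them. *)
Lemma left_of_component D (p : nat) Z W : connected_diagram D ->
    {in D, forall Y, Y.1 < Y.2} -> {in D, forall Y, outside Y p} ->
    Z \in D -> W \in D ->
  (p < Z.1) = (p < W.1).
Proof.
move=> conD lt12 outp ZD WD.
suff /subsetP/(_ Z ZD) : D \subset [set Y in D | (p < Y.1) == (p < W.1)].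
  by rewrite inE => /andP[_ /eqP].
apply: (connected_sub conD WD); first by rewrite inE WD eqxx.
move=> X Y; rewrite inE => /andP[XD /eqP eX] YD XY; rewrite inE YD -eX.
apply/eqP.
exact: (left_step_nat (lt12 X XD) (lt12 Y YD) (outp X XD) (outp Y YD) XY).
Qed.

(* Every component of [S :\ r] crosses [r], so all points of [S :\: D] but *)
(* the root lie in the same gap of [D] as [r.2]. *)
Lemma share_same_gap S r D (p q : 'I_m) : perfect_matching S ->
    connected_diagram S -> share_of S r D ->
    0 < p -> p \notin endpoints D -> q \in endpoints D ->
  (q < p) = (q < r.2).
Proof.
move=> pS conS shS p0 pD /endpointsP[Z ZD qZ].
have /perfect_matchingP[mS fullS] := pS; have [lt12 inj] := mS.
have [A [[rS _] [ASr minA] eD]] := shS.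
have r1 : r.1 = 0 :> nat by apply: perfect_first pS _; case: shS => ? [].
have sDS : D \subset S.
  by apply: subset_trans (share_of_sub shS) _; apply: subsetDl.
have : p \in endpoints S by rewrite fullS in_setT.
case/endpointsP => X XS pX.
have XD : X \notin D by apply: contra pD => XD; apply/endpointsP; exists X.
have [eXr|neXr] := eqVneq X r.
  move: pX; rewrite eXr => /orP[/eqP ep|/eqP-> //].
  by move: p0; rewrite ep r1.
have XSr : X \in S :\ r by rewrite in_setD1 neXr.
pose D' := component (S :\ r) X.
have sD'S : D' \subset S.
  by apply: subset_trans (component_sub _ _) _; apply: subsetDl.
have AD : A \in D by rewrite eD component_self.
have conD : connected_diagram D by apply: share_connected shS.
have D'D W : W \in D' -> W \notin D.
  move=> WD'; apply: contra XD; rewrite eD => WD.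
  by rewrite -(component_eq WD) (component_eq WD') component_self.
have injS := matching_starts_inj mS.
(* [D] contains the smallest chord of [S :\ r], so it reaches to the left of each [W] and, crossing
   none of them, stays outside. *)
have outq : {in D', forall W, outside W q}.
  move=> W WD'; have WD := D'D W WD'; have WS := subsetP sD'S W WD'.
  have WSr := subsetP (component_sub _ _) W WD'.
  suff /andP[out1 out2] : outside W Z.1 && outside W Z.2.
    by case/orP: qZ => /eqP->.
  apply: (outside_component mS sDS WS WD conD _ AD _ ZD).
    move=> Y YD; apply: contra WD => WY; rewrite eD in YD *.
    by apply: component_closed YD WSr _; rewrite crossesC.
  apply: (@first_chord_lt _ (S :\ r) A W) => //.
    by apply: starts_injS injS; apply: subsetDl.
  by apply: contraNneq WD => ->.
(* The span of [Y] contains [r.2] and the span of [X] contains [p]; [q] avoids both spans and has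
   them on the same side. *)
have [Y YD' rY] := component_crosses_root conS rS XSr.
have XD' : X \in D' by apply: component_self.
have lt12' : {in D', forall W, W.1 < W.2} by move=> W /(subsetP sD'S)/lt12.
have qXY : (q < X.1) = (q < Y.1).
  by apply: (left_of_component _ lt12' outq) => //; apply: component_connected.
have := outq X XD'; have := outq Y YD'; rewrite /outside.
move: rY; rewrite /crosses r1 ltn0 /= orbF => /and3P[_ ltYr ltrY].
have lt12X := lt12 X XS; have lt12Y := lt12' Y YD'.
have [X1p pX2] : X.1 <= p /\ p <= X.2.
  by case/orP: pX => /eqP->; split=> //; apply: ltnW.
clear -qXY ltYr ltrY lt12X lt12Y X1p pX2.
move: (nat_of_ord X.1) (nat_of_ord X.2) (nat_of_ord Y.1) (nat_of_ord Y.2)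
      (nat_of_ord r.2) (nat_of_ord p) (nat_of_ord q)
      qXY ltYr ltrY lt12X lt12Y X1p pX2.
by lia.
Qed.

End SharePosition.

(** By [share_same_gap] the non-root points outside [D] form an interval [p0, p1]; counting shows
    that it has 2 n1 - 1 points, so it is the gap with i = p0 - 1. *)
Lemma share_position n1 n2 (C : {set chord (n1 + n2).*2}) r D :
    C \in RCCD (n1 + n2) -> share_of C r D -> #|D| = n2 ->
  exists2 i, 0 < i < n2.*2 & in_position i C.
Proof.
move=> CR shC cD; have [_ pC conC injC cC] := RCCD_facts CR.
have /perfect_matchingP[mC fullC] := pC; have [lt12 inj] := mC.
have [A [[rC _] [ACr minA] eD]] := shC.
have r1 : r.1 = 0 :> nat by apply: perfect_first pC _; case: shC => ? [].
have sDC : D \subset C.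
  by apply: subset_trans (share_of_sub shC) _; apply: subsetDl.
have [rCD _] := share_of_first shC; have /setDP[_ rD] := rCD.
have AD : A \in D by rewrite eD component_self.
have rendD p : is_endpoint p r -> p \notin endpoints D.
  move=> pr; apply: contra rD => /endpointsP[X XD pX].
  by rewrite (inj p r X) // (subsetP sDC).
have r2_gt0 : 0 < r.2 by have := lt12 r rC; rewrite r1.
pose P := [set p : 'I_(n1 + n2).*2 | (0 < p) && (p \notin endpoints D)].
have r2P : r.2 \in P by rewrite inE r2_gt0 rendD // /is_endpoint eqxx orbT.
have sameP p q : p \in P -> q \in endpoints D -> (q < p) = (q < r.2).
  by rewrite inE => /andP[p0 pD] qD; apply: share_same_gap shC p0 pD qD.
have mD : matching D by apply: matchingS mC.
have cardP : #|P| + n2.*2 = (n1 + n2).*2.-1.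
  have := cardsC (r.1 |: endpoints D); rewrite card_ord cardsU1 card_endpoints //.
  rewrite rendD ?cD; last by rewrite /is_endpoint eqxx.
  have -> : ~: (r.1 |: endpoints D) = P.
    apply/setP => p; rewrite in_setC in_setU1 negb_or [RHS]inE lt0n.
    congr (~~ _ && _).
    apply/idP/idP => /eqP e; first by rewrite e r1.
    by apply/eqP/val_inj; rewrite /= e r1.
  by move=> /(congr1 predn) <-; rewrite addnC.
case: (@arg_minnP _ r.2 (mem P) (fun p => val p) r2P) => p0 /= p0P minP.
case: (@arg_maxnP _ r.2 (mem P) (fun p => val p) r2P) => p1 /= p1P maxP.
have le_p01 : p0 <= p1 := minP p1 p1P.
have eP : P = [set p : 'I_(n1 + n2).*2 | p0 <= p <= p1].
  apply/setP => p; rewrite [RHS]inE; apply/idP/andP => [pP|[le0 le1]].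
    by split; [apply: minP | apply: maxP].
  have p_gt0 : 0 < p.
    by move: p0P; rewrite inE => /andP[lt0 _]; apply: leq_trans le0.
  rewrite inE p_gt0 /=; apply/negP => pD.
  have nep q : q \in P -> p != q :> nat.
    rewrite inE => /andP[_]; apply: contra => /eqP/val_inj <-; exact: pD.
  have lt0 : p0 < p by rewrite ltn_neqAle eq_sym nep.
  have lt1 : p < p1 by rewrite ltn_neqAle nep.
  have := sameP p0 p p0P pD; rewrite -(sameP p1 p p1P pD) lt1.
  by rewrite ltnNge le0.
have cardP' : (p1 - p0).+1 + n2.*2 = (n1 + n2).*2.-1.
  by rewrite -cardP eP card_interval.
(* A chord of the share crossing the root has an endpoint on each side of the interval, which makes
   the gap an inner one: 0 < i < 2 n2. *)
have [Y YD rY] := component_crosses_root conC rC ACr.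
rewrite -eD in YD.
have endD X p : X \in D -> is_endpoint p X -> p \in endpoints D.
  by move=> XD pX; apply/endpointsP; exists X.
move: rY; rewrite /crosses r1 ltn0 /= orbF => /and3P[Y1_gt0 ltYr ltrY].
have Y1D : Y.1 \in endpoints D by apply: endD YD _; rewrite /is_endpoint eqxx.
have Y2D : Y.2 \in endpoints D by apply: endD YD _; rewrite /is_endpoint eqxx orbT.
have ltY0 : Y.1 < p0 by rewrite sameP.
have ltY2 : p1 < Y.2.
  rewrite ltn_neqAle leqNgt sameP // -leqNgt (ltnW ltrY) andbT.
  by move: p1P; rewrite inE => /andP[_]; apply: contra => /eqP/val_inj->.
exists p0.-1.
  have := ltn_ord Y.2; clear -cardP' ltY0 ltY2 le_p01 Y1_gt0.
  move: (nat_of_ord p0) (nat_of_ord p1) (nat_of_ord Y.1) (nat_of_ord Y.2)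
        cardP' ltY0 ltY2 le_p01 Y1_gt0.
  by lia.
apply/forallP => p; rewrite (shareE injC shC); apply/eqP.
have -> : (p \in endpoints D) = (0 < p) && (p \notin P).
  rewrite [p \in P]inE negb_and negbK; case: (posnP p) => //= p_eq0.
  rewrite (_ : p = r.1); last by apply: val_inj; rewrite /= p_eq0 r1.
  by apply: negbTE; apply: rendD; rewrite /is_endpoint eqxx.
rewrite /outer_point eP inE /in_gap; congr (_ && ~~ _).
clear -cardP' ltY0 le_p01 ltY2 Y1_gt0; have := ltn_ord Y.2.
move: (nat_of_ord p0) (nat_of_ord p1) (nat_of_ord Y.1) (nat_of_ord Y.2)
      (nat_of_ord p) cardP' ltY0 ltY2 le_p01 Y1_gt0.
by lia.
Qed.

Lemma in_position_inj n1 n2 i j (C : {set chord (n1 + n2).*2}) :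
    0 < n1 -> 0 < i < n2.*2 -> 0 < j < n2.*2 ->
  in_position i C -> in_position j C -> i = j.
Proof.
move=> n1_gt0; wlog lt_ij : i j / i < j.
  move=> wlog_ij hi hj Ci Cj; case: (ltngtP i j) => // lt; first exact: wlog_ij.
  by apply/esym/wlog_ij.
move=> /andP[i_gt0 _] /andP[_ lt_j] /forallP Ci /forallP Cj.
(* The point i + 1 is in the gap for [i] but is an outer point for [j]. *)
have lt_i1 : i.+1 < (n1 + n2).*2 by lia.
have := Ci (Ordinal lt_i1); rewrite (eqP (Cj (Ordinal lt_i1))) => /eqP.
by rewrite /outer_point /in_gap /=; lia.
Qed.

Lemma b_gt1_card m (S : {set chord m}) : 1 < b S -> 1 < #|S|.
Proof.
apply: contraTT; rewrite -!leqNgt leq_eqVlt ltnS leqn0 cards_eq0.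
case/orP=> [/cards1P[r ->]|/eqP->]; first by rewrite b1.
by rewrite /b /terminal_labels intersection_order0.
Qed.

(** * Comparison of coefficients *)

Section Coefficients.

Variables (K : fieldType) (f : nat -> K).
Local Open Scope ring_scope.

Lemma glue_facts n1 n2 i (n1_gt0 : (0 < n1)%N) (i_gt0 : (0 < i)%N)
    (lt_i : (i < n2.*2)%N) (A : {set chord n1.*2}) (B : {set chord n2.*2}) :
    A \in RCCD n1 -> B \in RCCD n2 ->
  let C := glue n1_gt0 i_gt0 lt_i A B in
  [/\ #|share C| = n2, in_position i C, b C = (b B).+1
    & f_of f C = f_of f A * f (b A - 1)%N * f_of f B].
Proof.
move=> AR BR C; have CR : C \in RCCD (n1 + n2) by apply: glue_RCCD.
have [r shC] : exists r, share_of C r (relabel (outer n1_gt0 i_gt0 lt_i) @: B).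
  exact: glue_share.
have [_ _ conC injC _] := RCCD_facts CR.
have [_ pA _ injA _] := RCCD_facts AR; have [_ pB _ injB cB] := RCCD_facts BR.
have monoI := inner_mono n1_gt0 i_gt0 lt_i.
have monoO := outer_mono n1_gt0 i_gt0 lt_i.
have [ntC ntD] := connected_share_roots injC conC shC.
have eI : C :\: relabel (outer n1_gt0 i_gt0 lt_i) @: B
        = relabel (inner n1_gt0 i_gt0 lt_i) @: A.
  rewrite setDUl setDv setU0; apply/setDidPl; rewrite disjoint_subset.
  apply/subsetP => _ /imsetP[X _ ->]; rewrite inE; apply/imsetP => -[Y _ e].
  by have := relI_neq_relO n1_gt0 i_gt0 lt_i X Y; rewrite e eqxx.
have eD := shareE injC shC; split.
- by rewrite eD (card_relabel monoO).
- apply/forallP => p; rewrite eD; apply/eqP/endpoints_relO => //.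
  by have /perfect_matchingP[] := pB.
- by rewrite (b_share injC shC ntC ntD) (b_relabel monoO).
rewrite (f_of_share f injC shC ntC ntD) eI.
by rewrite !(f_of_relabel monoI, f_of_relabel monoO, b_relabel monoI).
Qed.

Let weight k n (C : {set chord n.*2}) : K := f_of f C * f (b C - k)%N.

(** Gluing at gap [i] is a bijection from pairs (A, B). As b C = b B + 1, the condition on [C]
    becomes k - 1 <= b B, and the condition 1 <= b A in [g f 1] always holds. *)
Lemma sum_in_position k n1 n2 i :
    (1 < k)%N -> (0 < n1)%N -> (0 < i < n2.*2)%N ->
  \sum_(C in RCCD (n1 + n2) | [&& k <= b C, #|share C| == n2 & in_position i C]%N)
     weight k C
  = g f 1 n1 * g f (k - 1) n2.
Proof.
move=> k_gt1 n1_gt0 /andP[i_gt0 lt_i].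
rewrite /g big_distrlr pair_big /=.
rewrite (reindex_onto (fun AB => glue n1_gt0 i_gt0 lt_i AB.1 AB.2)
  (unglue n1_gt0 i_gt0 lt_i)) /=.
  apply: eq_big => [[A B]|[A B]] /=; last first.
    case/andP=> /and4P[CR kC cD posC] _.
    have C1 : (1 < #|glue n1_gt0 i_gt0 lt_i A B|)%N.
      by apply/b_gt1_card/(leq_trans k_gt1).
    have := unglueP n1_gt0 i_gt0 lt_i CR C1 (eqP cD) posC.
    rewrite glueK //= => -[AR BR _ _].
    have [_ _ bC fC] := glue_facts n1_gt0 i_gt0 lt_i AR BR.
    rewrite /weight fC bC -mulrA; congr (_ * _ * (_ * f _)).
    by move: k_gt1; clear; lia.
  rewrite glueK // eqxx andbT.
  apply/and4P/andP => [[CR kC cD posC]|[/andP[AR bA] /andP[BR bB]]].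
    have C1 : (1 < #|glue n1_gt0 i_gt0 lt_i A B|)%N.
      by apply/b_gt1_card/(leq_trans k_gt1).
    have := unglueP n1_gt0 i_gt0 lt_i CR C1 (eqP cD) posC.
    rewrite glueK //= => -[AR BR _ _].
    have [_ _ bC _] := glue_facts n1_gt0 i_gt0 lt_i AR BR.
    have [n1_gt0' _ _ injA cA] := RCCD_facts AR.
    rewrite AR BR /= b_gt0 -?card_gt0 ?cA //; split=> //.
    by move: kC k_gt1; rewrite bC; clear; lia.
  have [cD posC bC _] := glue_facts n1_gt0 i_gt0 lt_i AR BR.
  rewrite cD eqxx posC glue_RCCD // bC; split=> //.
  by move: bB k_gt1; clear; lia.
move=> C /and4P[CR kC cD posC].
have C1 : (1 < #|C|)%N by apply/b_gt1_card/(leq_trans k_gt1).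
have [_ _ eI eO] := unglueP n1_gt0 i_gt0 lt_i CR C1 (eqP cD) posC.
(* Regluing gives the union of the share and its complement, which is [C]. *)
rewrite /glue eI eO setUC -[RHS](setID C (share C)) setIC; congr (_ :|: _).
have [_ _ _ injC _] := RCCD_facts CR.
have [r [D shC]] := share_ofP injC C1.
rewrite (shareE injC shC); apply/esym/setIidPl.
by apply: subset_trans (share_of_sub shC) _; apply: subsetDl.
Qed.

Lemma g0 k : g f k 0 = 0.
Proof. by apply: big1 => C /andP[/RCCD_facts[]]. Qed.

(** Each diagram has exactly one position, by [share_position] and [in_position_inj], and every
    position contributes the same product. *)
Lemma sum_share k n1 n2 : (1 < k)%N ->
  \sum_(C in RCCD (n1 + n2) | (k <= b C)%N && (#|share C| == n2)) weight k C
  = (g f 1 n1 * g f (k - 1) n2) *+ n2.*2.-1.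
Proof.
move=> k_gt1.
have shareP (C : {set chord (n1 + n2).*2}) : C \in RCCD (n1 + n2) ->
    (k <= b C)%N -> #|share C| = n2 ->
  (0 < n1)%N /\ exists2 i, (0 < i < n2.*2)%N & in_position i C.
  move=> CR kC cD.
  have C1 : (1 < #|C|)%N by apply/b_gt1_card/(leq_trans k_gt1).
  have [_ _ _ injC cC] := RCCD_facts CR.
  have [r [D shC]] := share_ofP injC C1; rewrite (shareE injC shC) in cD.
  split; last exact: share_position shC cD.
  have : (#|D| < #|C|)%N.
    have [rCD _] := share_of_first shC; have /setDP[rC rD] := rCD.
    apply: proper_card; apply/properP; split; last by exists r.
    by apply: subset_trans (share_of_sub shC) _; apply: subsetDl.
  by rewrite cC cD -[X in (X < _)%N]add0n ltn_add2r.
(* For n1 = 0 the share would be the whole diagram, but it misses the root. *)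
case: (posnP n1) => [n1_eq0|n1_gt0].
  rewrite n1_eq0 in shareP *; rewrite g0 mul0r mul0rn.
  by apply: big1 => C /and3P[CR kC /eqP cD]; case: (shareP C CR kC cD).
transitivity (\sum_(C in RCCD (n1 + n2) | (k <= b C)%N && (#|share C| == n2))
  \sum_(i < n2.*2.-1 | in_position i.+1 C) weight k C).
  apply: eq_bigr => C /and3P[CR kC /eqP cD].
  have [_ [[|i] // lt_i posC]] := shareP C CR kC cD.
  have lt_i' : (i < n2.*2.-1)%N by move: lt_i; clear; lia.
  rewrite (big_pred1 (Ordinal lt_i')) // => j /=.
  apply/idP/eqP => [posj|-> //]; apply: val_inj => /=; apply: succn_inj.
  apply: (in_position_inj n1_gt0 _ _ posj posC) => //=.
  by have := ltn_ord j; clear; lia.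
rewrite (exchange_big_dep xpredT) //= -[n2.*2.-1 in RHS]card_ord -sumr_const.
apply: eq_big => // i _; rewrite -(@sum_in_position k n1 n2 i.+1) //.
  by apply: eq_bigl => C; rewrite -!andbA.
by have := ltn_ord i; clear; lia.
Qed.

Lemma g_sum_share k n : (1 < k)%N ->
  g f k n = \sum_(j < n.+1) (g f 1 j * g f (k - 1) (n - j)%N) *+ (n - j).*2.-1.
Proof.
move=> k_gt1.
have le_share (C : {set chord n.*2}) : C \in RCCD n -> (k <= b C)%N ->
    (#|share C| <= n)%N.
  move=> CR kC; have [_ _ _ injC cC] := RCCD_facts CR.
  have [r [D shC]] := share_ofP injC (b_gt1_card (leq_trans k_gt1 kC)).
  rewrite -[X in (_ <= X)%N]cC (shareE injC shC) subset_leq_card //.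
  by apply: subset_trans (share_of_sub shC) _; apply: subsetDl.
rewrite [LHS](partition_big (fun C => inord (n - #|share C|) : 'I_n.+1) xpredT) //=.
apply: eq_bigr => j _; have le_jn : (j <= n)%N by rewrite -ltnS.
pose sum n' := \sum_(C in RCCD n' | (k <= b C)%N && (#|share C| == (n - j)%N))
  weight k C.
(* The type of diagrams depends on the size, and j + (n - j) is only provably equal to n; the whole
   sum is therefore rewritten as a function of the size. *)
have castE n' : n' = n -> sum n' = sum n by move=> ->.
rewrite -[RHS]sum_share // -[RHS]/(sum _) (castE _ (subnKC le_jn)).
apply: eq_bigl => C; rewrite -andbA; case CR: (C \in RCCD n) => //=.
case kC: (k <= b C)%N => //=; have le_sn := le_share C CR kC.
rewrite -val_eqE /= inordK ?ltnS ?leq_subr //.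
by move: le_sn le_jn; move: #|share C| (nat_of_ord j) => s j'; clear; lia.
Qed.

Lemma fps_mulX_deriv (u : fps K) n :
  fps_mul (fpsX K) (fps_deriv u) n = u n *+ n.
Proof.
rewrite /fps_mul big_ord_recl /fpsX mul0r add0r; case: n => [|n].
  by rewrite big_ord0.
rewrite big_ord_recl mul1r subSS subn0 big1 ?addr0 // => i _.
by rewrite mul0r.
Qed.

End Coefficients.

Local Open Scope ring_scope.

Theorem proposition4p1 (K : fieldType) (charK : [pchar K] =i pred0)
    (f : nat -> K) (k : nat) (hk : (2 <= k)%N) :
  g f k =1
  fps_mul (g f 1)
    (fps_sub (fps_scale 2 (fps_mul (fpsX K) (fps_deriv (g f (k - 1)))))
             (g f (k - 1))).
Proof.
move=> n; rewrite g_sum_share //; apply: eq_bigr => j _.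
rewrite /fps_sub /fps_scale fps_mulX_deriv -mulrnAr; congr (_ * _).
(* At degree 0 the truncated factor is 0 while the operator gives -1; both are harmless because the
   constant coefficient of the series is 0. *)
case: (n - j)%N => [|l]; first by rewrite g0 !mul0rn mulr0 subr0.
by rewrite doubleS /= mulr_natl -mulrnA muln2 doubleS mulrSr addrK.
Qed.
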